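(* Let $X=(X_1,\ldots,X_d)\in\mathcal{B}(H)^d_{sa}$ be a $d$-tuple of self-adjoint contractions, and define $\mathrm{AC}(X)\subseteq\mathcal{B}(H)_{sa}$ as the collection of all self-adjoint operators which anticommute with each $X_j$. If $a_1,\ldots,a_d>0$ satisfy $\sum_{j=1}^da_j^{-2}\le1$, then there exists a dilation tuple $A\in\mathcal{B}(H\otimes\mathbb{C}^{4^{d-1}})^d_{sa}$ of $X$ with the following properties. (1) For each $j$, $\|A_j\|\le a_j$. (2) For $j\ne k$, $A_j$ and $A_k$ anticommute. (3) For each $W\in\mathrm{AC}(X)$, $W\otimes\begin{pmatrix}1&0\\0&-1\end{pmatrix}^{\otimes2(d-1)}$ anticommutes with every $A_j$. (4) The block entries of each $A_j$ are in the real unital $C^*$-algebra generated by $X_1,\ldots,X_d$.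
   Context: $\mathcal{B}(H)_{sa}$ denotes the self-adjoint bounded operators on the Hilbert space $H$, and $\mathcal{B}(H)^d_{sa}$ the $d$-tuples of such. Operators $S,T$ anticommute if $ST=-TS$. $Y\in\mathcal{B}(L)^d$ is a dilation of $X\in\mathcal{B}(H)^d$ if there is an isometry $V:H\to L$ with $X_i=V^*Y_iV$ for all $i$. Operators on $H\otimes\mathbb{C}^{m}$ are viewed as $m\times m$ block matrices with entries in $\mathcal{B}(H)$, and $\mathbb{C}^{4^{d-1}}$ is identified with $(\mathbb{C}^2)^{\otimes2(d-1)}$. The real unital $C^*$-algebra generated by $X_1,\ldots,X_d$ is the norm-closed real unital $*$-subalgebra of $\mathcal{B}(H)$ they generate. *)

(* Defs.v *)
From HB Require Import structures.
From mathcomp Require Import all_boot all_order all_algebra.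
From mathcomp Require Import complex mxtens.
From mathcomp Require Import ring.
From mathcomp Require Import boolp classical_sets functions reals.
From mathcomp Require Import interval_inference topology normedtype.
Set Implicit Arguments.
Unset Strict Implicit.
Unset Printing Implicit Defensive.
Import Order.TTheory GRing.Theory Num.Theory.
Import numFieldNormedType.Exports.
Local Open Scope classical_set_scope.
Local Open Scope complex_scope.
Local Open Scope ring_scope.

(* Complex Hilbert spaces. Following {dot _ for _}, the inner product is linear
   in its first argument and conjugate-linear in the second. Norms of modules
   over R[i] take their values in R[i], hence the casts t%:C below. *)
HB.mixin Record CompleteNormedModule_isHilbert (R : realType) H
    & CompleteNormedModule R[i] H := {
  hdot : {dot H for @Num.conj R[i]} ;
  hdot_norm : forall u : H, hdot u u = `|u| ^+ 2
}.
#[short(type="hilbertType")]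
HB.structure Definition Hilbert (R : realType) :=
  { H of CompleteNormedModule R[i] H & CompleteNormedModule_isHilbert R H }.

Local Notation "''[' u , v ]" := (hdot u v) : ring_scope.

Section dot_norm.
Variables (C : numClosedFieldType) (U : lmodType C).
Variable f : {dot U for @Num.conj C}.

Lemma dotC u v : f u v = (f v u)^*.
Proof. by rewrite hermC expr0 mul1r. Qed.

Lemma dot_CauchySchwarz u v : `|f u v| ^+ 2 <= f u u * f v v.
Proof.
have [->|v0] := eqVneq v 0.
  by rewrite !linear0r normr0 expr0n mulr0.
have fv0 : 0 < f v v by rewrite dnorm_gt0.
pose c := f u v / f v v.
have fvu : f v (c *: v) = f v v * c^* by rewrite linearZr_LR /= mulrC.
have : 0 <= f (u - c *: v) (u - c *: v) by exact: dnorm_ge0.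
rewrite dnormB dnormZ /= linearZr_LR /=.
have -> : `|c| ^+ 2 = `|f u v| ^+ 2 / (f v v) ^+ 2.
  by rewrite normrM normfV exprMn exprVn (ger0_norm (ltW fv0)).
have -> : c^* * f u v = `|f u v| ^+ 2 / f v v.
  rewrite rmorphM fmorphV /= [(f v v)^*]geC0_conj ?(ltW fv0)//.
  by rewrite mulrAC -normCKC.
rewrite rmorphM /= rmorphXn fmorphV /= [(f v v)^*]geC0_conj ?(ltW fv0)//.
rewrite conj_normC expr2 invfM mulrA divfK ?gt_eqF//.
by rewrite opprD addrA addrK subr_ge0 ler_pdivrMr.
Qed.

Lemma dot_le u v : `|f u v| <= sqrtC (f u u) * sqrtC (f v v).
Proof.
rewrite -sqrtCM ?nnegrE ?dnorm_ge0//.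
rewrite -(@ler_pXn2r _ 2)// ?nnegrE ?sqrtC_ge0 ?mulr_ge0 ?dnorm_ge0//.
by rewrite sqrtCK dot_CauchySchwarz.
Qed.

Lemma sqrt_dnormD u v :
  sqrtC (f (u + v) (u + v)) <= sqrtC (f u u) + sqrtC (f v v).
Proof.
rewrite -(@ler_pXn2r _ 2)// ?nnegrE ?addr_ge0 ?sqrtC_ge0 ?dnorm_ge0//.
rewrite sqrtCK sqrrD !sqrtCK dnormD /= addrAC lerD2r lerD2l.
have : f u v + (f u v)^* \is Num.real.
  by rewrite CrealE rmorphD /= conjCK addrC.
move=> /real_ler_norm/le_trans; apply.
rewrite (le_trans (ler_normD _ _))// norm_conjC -mulr2n.
by rewrite lerMn2r dot_le.
Qed.

Lemma sqrt_dnormZ a u : sqrtC (f (a *: u) (a *: u)) = `|a| * sqrtC (f u u).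
Proof. by rewrite dnormZ rootCMl ?exprn_ge0// sqrCK. Qed.

End dot_norm.

(* The Hilbert space tensor product H (x) C^m, realised as the m-fold Hilbert
   direct sum: x (x) e_k is the family with value x at k and 0 elsewhere. *)
Definition htens (R : realType) (H : hilbertType R) (m : nat) : Type :=
  {ffun 'I_m -> H}.

Section htens.
Variables (R : realType) (H : hilbertType R) (m : nat).
Local Notation HM := (htens H m).

HB.instance Definition _ := GRing.Lmodule.copy HM {ffun 'I_m -> H}.

Definition htens_dot (u v : HM) : R[i] := \sum_i '[u i, v i].

Let htens_dot_bilinear :
  bilinear_for (GRing.Scale.Law.clone _ _ ( *%R ) _)
    (GRing.Scale.Law.clone _ _ ((@Num.conj R[i]) \; *%R) _) htens_dot.
Proof.
split=> [v|u] a x y; rewrite /htens_dot /= mulr_sumr -big_split;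
  apply: eq_bigr => i _; rewrite !ffunE.
- by rewrite linearPl.
- by rewrite linearPr.
Qed.

HB.instance Definition _ := bilinear_isBilinear.Build R[i] HM HM R[i] _ _
  htens_dot htens_dot_bilinear.

Let htens_dot_hermitian u v :
  htens_dot u v = (-1) ^+ false * (htens_dot v u)^*.
Proof.
rewrite expr0 mul1r rmorph_sum; apply: eq_bigr => i _; exact: dotC.
Qed.

HB.instance Definition _ :=
  isHermitianSesquilinear.Build R[i] HM false _ htens_dot htens_dot_hermitian.

Let htens_dot_gt0 (u : HM) : u != 0 -> 0 < htens_dot u u.
Proof.
move=> u0; have [i ui0] : exists i, u i != 0.
  apply/existsP; apply: contra_neqT u0; rewrite negb_exists => /forallP u0.
  by apply/ffunP => i; rewrite ffunE; apply/eqP/negPn.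
rewrite /htens_dot (bigD1 i)//= ltr_wpDr ?dnorm_gt0//.
by apply: sumr_ge0 => j _; exact: dnorm_ge0.
Qed.

HB.instance Definition _ := isDotProduct.Build R[i] HM htens_dot htens_dot_gt0.

Definition htens_norm (u : HM) : R[i] := sqrtC (htens_dot u u).

Let htens_normD u v : htens_norm (u + v) <= htens_norm u + htens_norm v.
Proof. exact: sqrt_dnormD. Qed.

Let htens_normZ a u : htens_norm (a *: u) = `|a| * htens_norm u.
Proof. exact: sqrt_dnormZ. Qed.

Let htens_norm0_eq0 u : htens_norm u = 0 -> u = 0.
Proof. by move/eqP; rewrite sqrt_dnorm_eq0 => /eqP. Qed.

HB.instance Definition _ := Lmodule_isNormed.Build R[i] HM
  htens_normD htens_normZ htens_norm0_eq0.

Let htens_dot_norm (u : HM) : htens_dot u u = `|u| ^+ 2.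
Proof. by rewrite sqrtCK. Qed.

Lemma htens_norm_coord (u : HM) i : `|u i| <= `|u|.
Proof.
rewrite -(@ler_pXn2r _ 2)// ?nnegrE// -htens_dot_norm -hdot_norm.
rewrite /htens_dot (bigD1 i)//= lerDl.
by apply: sumr_ge0 => j _; exact: dnorm_ge0.
Qed.

Lemma htens_norm_sum (u : HM) : `|u| <= \sum_i `|u i|.
Proof.
rewrite -(@ler_pXn2r _ 2)// ?nnegrE ?sumr_ge0// -htens_dot_norm.
rewrite expr2 mulr_suml ler_sum// => i _; rewrite hdot_norm expr2.
by rewrite ler_wpM2l// (bigD1 i)//= lerDl sumr_ge0.
Qed.

Let htens_complete (F : set_system HM) : ProperFilter F -> cauchy F -> cvg F.
Proof.
move=> FF /cauchy_ballP Fc.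
have Fi i : cvg ((fun u : HM => u i) @ F).
  apply: cauchy_cvg; apply/cauchy_ballP => e e0.
  rewrite near_simpl.
  apply: filterS (Fc _ e0) => -[u v] /=; rewrite -!ball_normE /=.
  by apply: le_lt_trans; have := htens_norm_coord (u - v) i; rewrite !ffunE.
apply/cvg_ex; exists [ffun i => lim ((fun u : HM => u i) @ F)].
apply/cvgrPdist_lt => e e0; near=> u.
apply: le_lt_trans (htens_norm_sum _) _.
apply: (@le_lt_trans _ _ (\sum_(i < m) e / m.+1%:R)).
  apply: ler_sum => i _; rewrite !ffunE; apply: ltW.
  move: i; near: u; apply: filter_forall => i.
  have ei : 0 < e / m.+1%:R by rewrite divr_gt0.
  by have /cvgrPdist_lt/(_ _ ei) := Fi i; apply: filterS => u; rewrite ?ffunE.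
rewrite sumr_const card_ord -[ltLHS]mulr_natr mulrAC -mulrA gtr_pMr//.
by rewrite ltr_pdivrMr// mul1r ltr_nat.
Unshelve. all: by end_near. Qed.

HB.instance Definition _ := Uniform_isComplete.Build HM htens_complete.

HB.instance Definition _ :=
  CompleteNormedModule_isHilbert.Build R HM htens_dot_norm.

End htens.


Section bop_def.
Variables (R : realType) (H K : hilbertType R).

Definition bounded_linear : {pred H -> K} :=
  mem [set T : H -> K | linear T /\ continuous T].

(* B(H, K), written 'B(H, K). The composition product makes 'B(H) a ring. *)
Record bop := Bop {
  bop_fun :> H -> K;
  bop_subproof : bop_fun \in bounded_linear
}.

HB.instance Definition _ := [isSub for bop_fun].
HB.instance Definition _ := gen_eqMixin bop.
HB.instance Definition _ := gen_choiceMixin bop.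

Lemma bounded_linearP (T : H -> K) :
  T \in bounded_linear <-> linear T /\ continuous T.
Proof. by rewrite inE. Qed.

Let bounded_linear_submod_closed : submod_closed bounded_linear.
Proof.
split.
  apply/bounded_linearP; split; last exact: cst_continuous.
  by move=> a u v; rewrite scaler0 addr0.
move=> a S T /bounded_linearP[lS cS] /bounded_linearP[lT cT].
apply/bounded_linearP; split.
  move=> b u v; rewrite !fctE lS lT !scalerDr !scalerA mulrC -!addrA.
  congr (_ + _); rewrite addrCA; congr (_ + _).
move=> u; apply: cvgD; [apply: cvgZr; exact: cS|exact: cT].
Qed.

HB.instance Definition _ := GRing.isSubmodClosed.Build R[i] (H -> K)
  bounded_linear bounded_linear_submod_closed.
HB.instance Definition _ := [SubChoice_isSubLmodule of bop by <:].

HB.instance Definition _ (T : bop) :=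
  GRing.isLinear.Build R[i] H K *:%R T
    (proj1 (proj1 (bounded_linearP T) (bop_subproof T))).

Lemma bop_continuous (T : bop) : continuous T.
Proof. by have /bounded_linearP[] := bop_subproof T. Qed.

Lemma bopP (S T : bop) : S = T <-> S =1 T.
Proof. by split=> [->//|ST]; apply/val_inj/funext. Qed.

End bop_def.

Notation "''B(' H , K )" := (bop H K) (format "''B(' H ,  K )") : type_scope.
Notation "''B(' H )" := (bop H H) (format "''B(' H )") : type_scope.

Section bop_norm.
Variables (R : realType) (H K : hilbertType R).
Implicit Types (S T : 'B(H, K)) (u v : H).

Definition opnorm T : R[i] :=
  (sup [set complex.Re `|T u| | u in [set u : H | `|u| <= 1]])%:C.

Let Re_norm (L : hilbertType R) (x : L) : (complex.Re `|x|)%:C = `|x|.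
Proof. by rewrite RRe_real// ger0_real. Qed.

Let bopb T : exists2 M : R, 0 <= M & forall u, `|T u| <= M%:C * `|u|.
Proof.
have := @bop_continuous _ _ _ T => /linear_bounded_continuous/linear_boundedP.
move=> /pinfty_ex_gt0[M M0 TM]; exists (complex.Re M).
  by rewrite -ler0c RRe_real ?(ger0_real (ltW M0)) ?(ltW M0)//.
by move=> u; rewrite RRe_real ?(ger0_real (ltW M0))//; exact: TM.
Qed.

Let has_sup_opnorm T :
  has_sup [set complex.Re `|T u| | u in [set u : H | `|u| <= 1]].
Proof.
split; first by exists (complex.Re `|T 0|), 0; rewrite //= normr0.
have [M M0 TM] := bopb T; exists M => _ [u /= u1 <-].
by rewrite -lecR Re_norm (le_trans (TM u))// ler_piMr// ler0c.
Qed.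

Lemma opnorm_ge0 T : 0 <= opnorm T.
Proof.
rewrite ler0c; apply: (sup_upper_bound (has_sup_opnorm T)).
by exists 0; rewrite /= ?normr0 ?linear0 ?normr0.
Qed.

Lemma le_opnorm T u : `|T u| <= opnorm T * `|u|.
Proof.
have [->|u0] := eqVneq u 0; first by rewrite linear0 !normr0 mulr0.
have nu : 0 < `|u| by rewrite normr_gt0.
rewrite -ler_pdivrMr//.
have -> : `|T u| / `|u| = `|T (`|u|^-1 *: u)|.
  by rewrite linearZ/= normrZ normfV normr_id mulrC.
rewrite -Re_norm lecR; apply: (sup_upper_bound (has_sup_opnorm T)).
exists (`|u|^-1 *: u) => //=.
by rewrite normrZ normfV normr_id mulVf ?gt_eqF.
Qed.

Lemma opnorm_le T (c : R[i]) :
  0 <= c -> (forall u, `|T u| <= c * `|u|) -> opnorm T <= c.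
Proof.
move=> c0 Tc; rewrite -(RRe_real (ger0_real c0)) lecR.
apply: ge_sup; first by have [] := has_sup_opnorm T.
move=> _ [u /= u1 <-]; rewrite -lecR Re_norm RRe_real ?ger0_real//.
by rewrite (le_trans (Tc u))// ler_piMr.
Qed.

Let opnormD S T : opnorm (S + T) <= opnorm S + opnorm T.
Proof.
apply: opnorm_le => [|u]; first by rewrite addr_ge0 ?opnorm_ge0.
by rewrite mulrDl (le_trans (ler_normD _ _))// lerD// le_opnorm.
Qed.

Let opnormZ a T : opnorm (a *: T) = `|a| * opnorm T.
Proof.
have le b S : opnorm (b *: S) <= `|b| * opnorm S.
  apply: opnorm_le => [|u]; first by rewrite mulr_ge0 ?opnorm_ge0.
  by rewrite /= normrZ -mulrA ler_wpM2l// le_opnorm.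
apply/eqP; rewrite eq_le le/=.
have [->|a0] := eqVneq a 0; first by rewrite normr0 mul0r opnorm_ge0.
rewrite -ler_pdivlMl ?normr_gt0// -normfV.
by rewrite -{1}[T](scalerK a0) le.
Qed.

Let opnorm0_eq0 T : opnorm T = 0 -> T = 0.
Proof.
move=> T0; apply/bopP => u; apply/eqP; rewrite -normr_le0.
by rewrite (le_trans (le_opnorm T u))// T0 mul0r.
Qed.

HB.instance Definition _ := Lmodule_isNormed.Build R[i] 'B(H, K)
  opnormD opnormZ opnorm0_eq0.

Lemma normopE T : `|T| = opnorm T. Proof. by []. Qed.

End bop_norm.

Lemma bounded_linear_bound (R : realType) (H K : hilbertType R) (T : H -> K)
    (c : R[i]) :
  linear T -> (forall u, `|T u| <= c * `|u|) -> T \in @bounded_linear R H K.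
Proof.
move=> lT Tc; apply/bounded_linearP; split => //.
pose T' : {linear H -> K} :=
  HB.pack_for {linear H -> K} T (GRing.isLinear.Build _ _ _ _ T lT).
apply: (@bounded_linear_continuous _ _ _ T'); apply/linear_boundedP.
exists `|c|; split => [|x cx u]; first exact: normr_real.
rewrite (le_trans (Tc u))//.
have [->|u0] := eqVneq u 0; first by rewrite normr0 !mulr0.
have cu0 : 0 <= c.
  by rewrite -(@pmulr_lge0 _ `|u|) ?normr_gt0// (le_trans _ (Tc u)).
by rewrite ler_wpM2r// -(ger0_norm cu0) ltW.
Qed.

Section bop_ring.
Variables (R : realType).

Lemma bcomp_subproof (H K L : hilbertType R) (S : 'B(K, L)) (T : 'B(H, K)) :
  S \o T \in @bounded_linear R H L.
Proof.
apply: (@bounded_linear_bound _ _ _ _ (`|S| * `|T|)).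
  by move=> a u v /=; rewrite !linearP.
move=> u /=; rewrite (le_trans (le_opnorm S _))// -mulrA.
by apply: ler_wpM2l; [exact: opnorm_ge0|exact: le_opnorm].
Qed.

Definition bcomp (H K L : hilbertType R) (S : 'B(K, L)) (T : 'B(H, K)) :
  'B(H, L) := Bop (bcomp_subproof S T).

Variable H : hilbertType R.

Lemma bid_subproof : idfun \in @bounded_linear R H H.
Proof.
by apply: (@bounded_linear_bound _ _ _ _ 1) => // u; rewrite mul1r.
Qed.

Definition bid : 'B(H) := Bop bid_subproof.

Let bcompA : associative (@bcomp H H H).
Proof. by move=> ? ? ?; apply/bopP. Qed.
Let bcomp1l : left_id bid (@bcomp H H H).
Proof. by move=> ?; apply/bopP. Qed.
Let bcomp1r : right_id bid (@bcomp H H H).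
Proof. by move=> ?; apply/bopP. Qed.
Let bcompDl : left_distributive (@bcomp H H H) +%R.
Proof. by move=> ? ? ?; apply/bopP. Qed.
Let bcompDr : right_distributive (@bcomp H H H) +%R.
Proof. by move=> ? ? ?; apply/bopP => u /=; rewrite linearD. Qed.

HB.instance Definition _ := GRing.Zmodule_isPzRing.Build 'B(H)
  bcompA bcomp1l bcomp1r bcompDl bcompDr.

End bop_ring.

(* Riesz representation: the functional u |-> |u|^2 - 2 Re (f u) attains its
   infimum at the vector representing f. *)
Section riesz.
Variables (R : realType) (H : hilbertType R) (f : {scalar H}) (M : R[i]).
Hypotheses (M0 : 0 <= M) (fM : forall u, `|f u| <= M * `|u|).

Let q (u : H) : R[i] := `|u| ^+ 2 - (f u + (f u)^*).
Let Q u : R := complex.Re (q u).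

Let qR u : (Q u)%:C = q u.
Proof.
by rewrite RRe_real// realB ?realX ?normr_real// CrealE rmorphD /= conjCK addrC.
Qed.

Let addc_ge (z : R[i]) : z + z^* <= `|z| *+ 2.
Proof.
have : z + z^* \is Num.real by rewrite CrealE rmorphD /= conjCK addrC.
move=> /real_ler_norm/le_trans; apply.
by rewrite (le_trans (ler_normD _ _))// norm_conjC.
Qed.

Let addc_le (z : R[i]) : - (z + z^*) <= `|z| *+ 2.
Proof. by rewrite opprD -rmorphN (le_trans (addc_ge _))// normrN. Qed.

Let q_lb u : - M ^+ 2 <= q u.
Proof.
have : 0 <= (`|u| - M) ^+ 2.
  by rewrite real_exprn_even_ge0// realB ?normr_real// ger0_real.
rewrite sqrrB => qM; rewrite -subr_ge0 opprK (le_trans qM)// lerD2r lerD2l.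
rewrite lerN2 (le_trans (addc_ge _))// lerMn2r/= mulrC.
by rewrite fM.
Qed.

Let qD w h :
  q (w + h) = q w + (('[h, w] - f h) + ('[h, w] - f h)^*) + `|h| ^+ 2.
Proof.
rewrite /q -!hdot_norm dnormD /= linearD /= (dotC _ h w) !rmorphD !rmorphN /=.
by rewrite conjCK; ring.
Qed.

Let q_mid u v : `|u - v| ^+ 2 = (q u + q v) *+ 2 - (q (2^-1 *: (u + v))) *+ 4.
Proof.
have -> : u = v + (u - v) by rewrite addrC subrK.
set h := u - v.
have -> : v + h - v = h by rewrite addrC addKr.
have -> : 2^-1 *: (v + h + v) = v + 2^-1 *: h.
  rewrite addrAC -mulr2n scalerDr -scalerMnr -scaler_nat scalerA.
  by rewrite divff ?pnatr_eq0// scale1r.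
rewrite !qD linearZl_LR linearZ /= -mulrBr rmorphM /= fmorphV /= rmorph_nat.
rewrite normrZ normfV normr_nat.
by field.
Qed.

Let m := inf (range Q).

Let has_inf_Q : has_inf (range Q).
Proof.
split; first by exists (Q 0), 0.
exists (complex.Re (- M ^+ 2)) => _ [u _ <-].
rewrite -lecR qR RRe_real ?q_lb//.
by rewrite realN realX// ger0_real.
Qed.

Let m_le u : m%:C <= q u.
Proof. by rewrite -qR lecR; apply: ge_inf; [have [] := has_inf_Q|exists u]. Qed.

Let natSinv_lt (d : R) : 0 < d -> \forall n \near \oo, n.+1%:R^-1 < d.
Proof. by move=> /posnumP[e]; exact: near_infty_natSinv_lt. Qed.

Let q_min : exists w, q w <= m%:C.
Proof.
have /choice[u uP] : forall n : nat, exists u, q u < (m + n.+1%:R^-1)%:C.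
  move=> n; have n0 : 0 < n.+1%:R^-1 :> R by rewrite invr_gt0.
  have [_ [v _ <-] Qv] := inf_adherent n0 has_inf_Q.
  by exists v; rewrite -qR ltcR.
have uu n k : `|u n - u k| ^+ 2 <= ((n.+1%:R^-1 + k.+1%:R^-1) *+ 2)%:C.
  rewrite q_mid.
  pose b := (m + n.+1%:R^-1 + (m + k.+1%:R^-1))%:C *+ 2 - m%:C *+ 4.
  rewrite (le_trans (_ : _ <= b))//.
    by rewrite lerB// lerMn2r/= ?m_le// rmorphD lerD// ltW.
  rewrite /b -!rmorphMn -rmorphB lecR le_eqVlt; apply/orP; left; apply/eqP.
  by ring.
have uc : cvg (u @ \oo).
  apply: cauchy_cvg; apply/cauchy_ballP => e e0.
  have er : 0 < complex.Re e by rewrite -ltcR RRe_real ?gtr0_real.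
  pose d : R := complex.Re e ^+ 2 / 4.
  have d0 : 0 < d by rewrite divr_gt0 ?exprn_gt0.
  rewrite near_simpl; near=> n k.
  rewrite -ball_normE /= -(@ltr_pXn2r _ 2)// ?nnegrE ?(ltW e0)//.
  rewrite (le_lt_trans (uu _ _))// -(RRe_real (gtr0_real e0)) -rmorphXn ltcR.
  have -> : complex.Re e ^+ 2 = (d + d) *+ 2 by rewrite /d; field.
  rewrite ltrMn2r/= ltrD//.
  - by near: n; exact: natSinv_lt.
  - by near: k; exact: natSinv_lt.
have /cvg_ex[w uw] := uc.
exists w; rewrite -qR lecR; apply/ler_addgt0Pr => e e0.
pose K : R[i] := (`|w| + M) *+ 2 + 1.
have K0 : 0 < K by rewrite ltr_wpDl ?mulrn_wge0 ?addr_ge0.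
have e2 : 0 < e / 2 by rewrite divr_gt0.
have eK : 0 < (e / 2)%:C / K by rewrite divr_gt0// ltcR.
near \oo => n.
have wn : `|w - u n| < (e / 2)%:C / K.
  by near: n; move/cvgrPdist_lt : uw; apply.
have un : q (u n) < (m + e / 2)%:C.
  rewrite (lt_trans (uP n))// ltcR ltrD2l.
  by near: n; exact: natSinv_lt.
rewrite -lecR qR; pose h := u n - w.
have -> : q w = q (u n) - ('[h, w] + '[h, w]^*) + (f h + (f h)^*) - `|h| ^+ 2.
  have -> : u n = w + h by rewrite addrC subrK.
  by rewrite qD rmorphB /=; ring.
have hK : `|h| * K <= (e / 2)%:C.
  by rewrite -ler_pdivlMr// /h distrC ltW.
have hw : `|'[h, w]| <= `|h| * `|w|.
  have := dot_le hdot h w.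
  by rewrite !hdot_norm !sqrCK.
have -> : (m + e)%:C = (m + e / 2)%:C + (e / 2)%:C.
  by rewrite -rmorphD /= -addrA -splitr.
move: (q (u n)) un => qn un.
apply: (@le_trans _ _ (qn + `|h| * K)); last by rewrite lerD// ltW.
rewrite -!addrA lerD2l.
apply: (@le_trans _ _ ((`|h| * `|w|) *+ 2 + (M * `|h|) *+ 2)).
  rewrite lerD//.
    by rewrite (le_trans (addc_le _))// lerMn2r/= hw.
  rewrite addrA lerBlDr ler_wpDr ?exprn_ge0//.
  by rewrite (le_trans (addc_ge _))// lerMn2r/= fM.
rewrite /K mulrDr mulr1 mulrnAr mulrDr mulrnDl [`|h| * M]mulrC lerDl//.
Unshelve. all: by end_near. Qed.

Lemma riesz : exists w, forall u, f u = '[u, w].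
Proof.
have [w qw] := q_min; exists w => v.
have qh h : 0 <= (('[h, w] - f h) + ('[h, w] - f h)^*) + `|h| ^+ 2.
  have := le_trans qw (m_le (w + h)); rewrite qD -addrA lerDl.
  done.
pose c := '[v, w] - f v.
have [/eqP|c0] := eqVneq c 0; first by rewrite subr_eq0 => /eqP.
pose s : R[i] := (`|v| ^+ 2 + 1)^-1.
have v1 : 0 < `|v| ^+ 2 + 1 by rewrite ltr_wpDl ?exprn_ge0.
have s0 : 0 < s by rewrite invr_gt0.
have := qh (- s * c^* *: v).
rewrite linearZl_LR linearZ /= -mulrBr -/c !rmorphM rmorphN /= conjCK.
rewrite (geC0_conj (ltW s0)) normrZ !normrM normrN norm_conjC.
rewrite (ger0_norm (ltW s0)).
rewrite !exprMn.
have -> : - s * c^* * c = - s * `|c| ^+ 2 by rewrite normCKC mulrA.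
have -> : - s * c * c^* = - s * `|c| ^+ 2 by rewrite normCK mulrA.
have -> : - s * `|c| ^+ 2 + - s * `|c| ^+ 2 + s ^+ 2 * `|c| ^+ 2 * `|v| ^+ 2 =
  s * `|c| ^+ 2 * (s * `|v| ^+ 2 - 2) by ring.
rewrite pmulr_rge0 ?mulr_gt0 ?exprn_gt0 ?normr_gt0// subr_ge0 => s2.
have : s * `|v| ^+ 2 <= 1 by rewrite mulrC ler_pdivrMr// mul1r lerDl.
by move=> /(le_trans s2); rewrite lern1.
Qed.
End riesz.

Section adjoint.
Variables (R : realType) (H K : hilbertType R).

Lemma adj_ex (T : 'B(H, K)) :
  exists S : 'B(K, H), forall u v, '[T u, v] = '[u, S v].
Proof.
pose f v u := '[T u, v].
have fS v : scalar (f v) by move=> a x y; rewrite /f linearP linearPl.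
have /choice[S ST] : forall v, exists w, forall u, '[T u, v] = '[u, w].
  move=> v; pose f' : {scalar H} :=
    HB.pack_for {scalar H} (f v) (GRing.isLinear.Build _ _ _ _ (f v) (fS v)).
  apply: (@riesz _ _ f' (`|T| * `|v|)) => [|u]; first by rewrite mulr_ge0.
  rewrite mulrAC (le_trans (dot_le hdot _ _))// !hdot_norm !sqrCK//.
  by rewrite ler_wpM2r//; exact: le_opnorm.
have inj (x y : H) : (forall u, '[u, x] = '[u, y]) -> x = y.
  move=> xy; apply/eqP; rewrite -subr_eq0 -(dnorm_eq0 hdot).
  by rewrite linearBr /= xy subrr.
have lS : linear S.
  by move=> a x y; apply: inj => u; rewrite -ST !linearPr/= !ST.
have bS : S \in @bounded_linear R K H.
  apply: (@bounded_linear_bound _ _ _ _ `|T|) => // v.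
  have [->|Sv0] := eqVneq (S v) 0; first by rewrite normr0 mulr_ge0.
  rewrite -(@ler_pM2l _ `|S v|) ?normr_gt0// -expr2 -hdot_norm -ST.
  have := dot_le hdot (T (S v)) v; rewrite !hdot_norm !sqrCK// => Tv.
  have T0 : 0 <= '[T (S v), v] by rewrite ST dnorm_ge0.
  rewrite -(ger0_norm T0) (le_trans Tv)// mulrCA mulrA ler_wpM2r//.
  exact: le_opnorm.
by exists (Bop bS).
Qed.

Definition adj (T : 'B(H, K)) : 'B(K, H) := projT1 (cid (adj_ex T)).

Lemma adjP (T : 'B(H, K)) u v : '[T u, v] = '[u, adj T v].
Proof. by rewrite /adj; case: cid. Qed.

End adjoint.

Definition selfadj (R : realType) (H : hilbertType R) (T : 'B(H)) : Prop :=
  adj T = T.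

Definition anticommute (R : realType) (H : hilbertType R)
    (S T : 'B(H)) : Prop :=
  S * T = - (T * S).

Definition ACset (R : realType) (H : hilbertType R) (d : nat)
    (X : 'I_d -> 'B(H)) : set 'B(H) :=
  [set W | selfadj W /\ forall j, anticommute W (X j)].

Definition dilation (R : realType) (H L : hilbertType R) (d : nat)
    (X : 'I_d -> 'B(H)) (Y : 'I_d -> 'B(L)) : Prop :=
  exists2 V : 'B(H, L), (forall u, `|V u| = `|u|) &
    forall j, X j = bcomp (adj V) (bcomp (Y j) V).

(* Closedness refers to the operator norm topology of 'B(H), and scaling is by
   real scalars only. *)
Record real_cstar_subalgebra (R : realType) (H : hilbertType R)
    (S : set 'B(H)) : Prop := {
  rcs_closed : closed S ;
  rcs_one : S 1 ;
  rcs_add : forall T U, S T -> S U -> S (T + U) ;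
  rcs_mul : forall T U, S T -> S U -> S (T * U) ;
  rcs_scale : forall (t : R) T, S T -> S (t%:C *: T) ;
  rcs_adj : forall T, S T -> S (adj T)
}.

Definition real_cstar_gen (R : realType) (H : hilbertType R) (d : nat)
    (X : 'I_d -> 'B(H)) : set 'B(H) :=
  smallest (@real_cstar_subalgebra R H) (range X).

Section blocks.
Variables (R : realType) (H : hilbertType R) (m : nat).
Local Notation HM := (htens H m).

Definition htens_inj (l : 'I_m) (u : H) : HM :=
  [ffun k => if k == l then u else 0].

Definition htens_proj (k : 'I_m) (u : HM) : H := u k.

Lemma htens_inj_subproof l : htens_inj l \in @bounded_linear R H HM.
Proof.
apply: (@bounded_linear_bound _ _ _ _ 1).
  move=> a u v; apply/ffunP => k; rewrite !ffunE.
  by case: eqP => // _; rewrite scaler0 addr0.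
move=> u; rewrite mul1r (le_trans (htens_norm_sum _))// (bigD1 l)//=.
rewrite !ffunE eqxx.
by rewrite big1 ?addr0// => k /negPf kl; rewrite ffunE kl normr0.
Qed.

Lemma htens_proj_subproof k : htens_proj k \in @bounded_linear R HM H.
Proof.
apply: (@bounded_linear_bound _ _ _ _ 1).
  by move=> a u v; rewrite /htens_proj !ffunE.
by move=> u; rewrite mul1r htens_norm_coord.
Qed.

Definition blockentry (A : 'B(HM)) (k l : 'I_m) : 'B(H) :=
  bcomp (Bop (htens_proj_subproof k)) (bcomp A (Bop (htens_inj_subproof l))).

Lemma blockentryE A k l u : blockentry A k l u = A (htens_inj l u) k.
Proof. by []. Qed.

(* W (x) M is the block operator with (k, l) entry M k l *: W. *)
Definition optens_fun (W : 'B(H)) (M : 'M[R[i]]_m) (u : HM) : HM :=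
  [ffun k => \sum_l M k l *: W (u l)].

Lemma optens_subproof W M : optens_fun W M \in @bounded_linear R HM HM.
Proof.
apply: (@bounded_linear_bound _ _ _ _ (\sum_k \sum_l `|M k l| * `|W|)).
  move=> a u v; apply/ffunP => k; rewrite !ffunE scaler_sumr -big_split/=.
  apply: eq_bigr => l _.
  by rewrite !ffunE linearP scalerDr !scalerA [a * _]mulrC.
move=> u; rewrite (le_trans (htens_norm_sum _))// mulr_suml ler_sum// => k _.
rewrite ffunE (le_trans (ler_norm_sum _ _ _))// mulr_suml ler_sum// => l _.
rewrite normrZ -mulrA ler_wpM2l// (le_trans (le_opnorm W _))//.
by apply: ler_wpM2l; [exact: opnorm_ge0|exact: htens_norm_coord].
Qed.

Definition optens (W : 'B(H)) (M : 'M[R[i]]_m) : 'B(HM) :=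
  Bop (optens_subproof W M).

Lemma blockentry_optens W M k l : blockentry (optens W M) k l = M k l *: W.
Proof.
apply/bopP => u; rewrite blockentryE ffunE (bigD1 l)//= ffunE eqxx.
rewrite big1 ?addr0//.
by move=> j /negPf jl; rewrite ffunE jl linear0 scaler0.
Qed.

End blocks.

(* The matrix diag(1, -1), and its tensor power of exponent 2n transported along
   (C^2)^(x)2n = C^(4^n). *)
Definition sigmaZ (R : realType) : 'M[R[i]]_2 :=
  diag_mx (\row_(i < 2) (-1) ^+ i).

Definition sigmaZ_tens (R : realType) (n : nat) : 'M[R[i]]_(4 ^ n) :=
  castmx (expnM 2 2 n, expnM 2 2 n) (sigmaZ R ^t (2 * n)).

(* Main.v *)
(* The scalar matrices A_j = a_j (1 (x) E_j) are already a dilation of X, where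
   E_1, ..., E_d are real symmetric anticommuting involutions that are odd for
   the grading by the tensor power of diag(1, -1) (Jordan-Wigner matrices); only
   the isometry V depends on X. Put Y_j = X_j / a_j, so that \sum_j Y_j^2 <= 1,
   and choose S with S^* S = 1 - \sum_j Y_j^2. If w is the vacuum vector, then
     V u = (w (x) u + \sum_j E_j w (x) Y_j u + E_(d+1) w (x) S u) / sqrt 2
   is an isometry with V^* E_j V = Y_j, because w^T E_i E_j w is the Kronecker
   delta and odd elements vanish in the vacuum state. This needs d + 1
   generators, hence d >= 3. For d = 2 the isometry is first built in a larger
   space, then compressed to H (x) C^4 by means of the square root of a positive
   operator on H (x) C^2. For d = 1 take A = X. *)
From HB Require Import structures.
Require Import Defs.
From mathcomp Require Import all_boot all_order all_algebra.
From mathcomp Require Import complex mxtens ring lra.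
From mathcomp Require Import boolp classical_sets reals topology normedtype.
From mathcomp Require Import interval_inference.
Set Implicit Arguments.
Unset Strict Implicit.
Unset Printing Implicit Defensive.
Import Order.TTheory GRing.Theory Num.Theory.
Import numFieldNormedType.Exports.
Local Open Scope classical_set_scope.
Local Open Scope complex_scope.
Local Open Scope ring_scope.

Local Notation "''[' u , v ]" := (hdot u v) : ring_scope.

(** * Jordan-Wigner matrices *)

Section pauli.
Variable R : comNzRingType.

Definition pauliX : 'M[R]_2 := \matrix_(i, j) (i != j)%:R.
Definition pauliZ : 'M[R]_2 := diag_mx (\row_(i < 2) (-1) ^+ i).

Lemma pauliX_tr : pauliX^T = pauliX.
Proof. by apply/matrixP => i j; rewrite !mxE eq_sym. Qed.

Lemma pauliX_sqr : pauliX *m pauliX = 1%:M.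
Proof.
apply/matrixP => -[[|[|//]] ?] [[|[|//]] ?];
by rewrite !mxE !big_ord_recl big_ord0 !mxE /= ?(mul0r, mulr0, mul1r, addr0, add0r).
Qed.

Lemma pauliZ_tr : pauliZ^T = pauliZ. Proof. exact: tr_diag_mx. Qed.

Lemma pauliZ_sqr : pauliZ *m pauliZ = 1%:M.
Proof.
rewrite /pauliZ mulmx_diag -diag_const_mx; congr diag_mx.
by apply/rowP => i; rewrite !mxE -expr2 sqrr_sign.
Qed.

Lemma pauliZX : pauliZ *m pauliX = - (pauliX *m pauliZ).
Proof.
rewrite /pauliZ mul_diag_mx mul_mx_diag; apply/matrixP => -[[|[|//]] ?] [[|[|//]] ?];
by rewrite !mxE /= ?(expr0, expr1, mulr0, mul0r, mul1r, mulr1, oppr0, opprK).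
Qed.

End pauli.

Section tens_opp.
Variables (R : comPzRingType) (m n p q : nat).
Implicit Types (A : 'M[R]_(m, n)) (B : 'M[R]_(p, q)).

Lemma tensNmx A B : (- A) *t B = - (A *t B).
Proof. by apply/matrixP => i j; rewrite !mxE mulNr. Qed.

Lemma tensmxN A B : A *t (- B) = - (A *t B).
Proof. by apply/matrixP => i j; rewrite !mxE mulrN. Qed.

Lemma tens1mx1 : 1%:M *t 1%:M = 1%:M :> 'M[R]_(m * n).
Proof.
apply/matrixP => i j; case: (mxtens_indexP i) => i0 i1.
case: (mxtens_indexP j) => j0 j1; rewrite tensmxE !mxE -natrM mulnb.
congr (_%:R); congr nat_of_bool.
apply/andP/eqP => [[/eqP-> /eqP->]//|].
by move=> /(can_inj (@mxtens_indexK _ _)) [-> ->].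
Qed.

End tens_opp.

(* Z is the grading operator; only the E i with i < n matter. *)
Record graded_clifford (R : comNzRingType) (m n : nat) (Z : 'M[R]_m)
    (E : nat -> 'M[R]_m) (w : 'cV[R]_m) : Prop := GradedClifford {
  gc_tr : forall i, (i < n)%N -> (E i)^T = E i ;
  gc_sqr : forall i, (i < n)%N -> E i *m E i = 1%:M ;
  gc_anti : forall i j, (i < n)%N -> (j < n)%N -> i != j ->
    E i *m E j = - (E j *m E i) ;
  gc_odd : forall i, (i < n)%N -> Z *m E i = - (E i *m Z) ;
  gc_Ztr : Z^T = Z ;
  gc_unit : w^T *m w = 1%:M ;
  gc_even : Z *m w = w
}.

Section jordan_wigner.
Variable R : comNzRingType.
Local Notation X := (pauliX R).
Local Notation Z := (pauliZ R).

(** Generator j is Z^(x)j (x) X (x) 1^(x)(n-j). Indices beyond [n] repeat the last generator, hence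
    the bounds on the indices in the anticommutation lemma. *)
Fixpoint jordan_wigner (n j : nat) : 'M[R]_(2 ^ n.+1) :=
  match n, j with
  | 0, _ => X
  | _.+1, 0 => X *t 1%:M
  | n'.+1, j'.+1 => Z *t jordan_wigner n' j'
  end.

Lemma ntens_pauliZ_tr n : (Z ^t n.+1)^T = Z ^t n.+1.
Proof.
elim: n => [|n IH]; first exact: pauliZ_tr.
by rewrite [LHS](trmx_tens Z) IH pauliZ_tr.
Qed.

Lemma jordan_wigner_tr n j : (jordan_wigner n j)^T = jordan_wigner n j.
Proof.
elim: n j => [|n IH] [|j] /=; rewrite ?pauliX_tr//.
  by rewrite [LHS](trmx_tens X) pauliX_tr trmx1.
by rewrite [LHS](trmx_tens Z) pauliZ_tr IH.
Qed.

Lemma jordan_wigner_sqr n j : jordan_wigner n j *m jordan_wigner n j = 1%:M.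
Proof.
elim: n j => [|n IH] [|j] /=; rewrite ?pauliX_sqr//.
  by rewrite tensmx_mul pauliX_sqr mulmx1 tens1mx1.
by rewrite tensmx_mul pauliZ_sqr IH tens1mx1.
Qed.

Lemma jordan_wigner_anti n i j : (i < n.+1)%N -> (j < n.+1)%N -> i != j ->
  jordan_wigner n i *m jordan_wigner n j =
  - (jordan_wigner n j *m jordan_wigner n i).
Proof.
elim: n i j => [|n IH] [|i] [|j] //= il jl ij; rewrite !tensmx_mul.
- by rewrite mul1mx mulmx1 pauliZX tensNmx opprK.
- by rewrite mul1mx mulmx1 pauliZX tensNmx.
- by rewrite IH// pauliZ_sqr tensmxN.
Qed.

Lemma jordan_wigner_odd n j : (j < n.+1)%N ->
  Z ^t n.+1 *m jordan_wigner n j = - (jordan_wigner n j *m Z ^t n.+1).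
Proof.
elim: n j => [|n IH] [|j] //= jl; rewrite ?ntensmx1 ?pauliZX//.
  by rewrite ntensmxSS !tensmx_mul mul1mx mulmx1 pauliZX tensNmx.
by rewrite ntensmxSS !tensmx_mul IH// tensmxN.
Qed.

(** The vacuum is the tensor power of e_0, the eigenvector of Z with eigenvalue 1. *)
Lemma ntens_pauliZ_vacuum n : exists w : 'cV[R]_(2 ^ n.+1),
  w^T *m w = 1%:M /\ Z ^t n.+1 *m w = w.
Proof.
pose e : 'cV[R]_2 := delta_mx 0 0.
have ee : e^T *m e = 1%:M.
  by rewrite trmx_delta mul_delta_mx [RHS]mx11_scalar; apply/matrixP=> i j; rewrite !ord1 !mxE.
have Ze : Z *m e = e.
  rewrite /pauliZ mul_diag_mx; apply/matrixP => -[[|[|//]] ?] j;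
  by rewrite !ord1 !mxE /= ?mulr1 ?mulr0.
elim: n => [|n [w [ww Zw]]]; first by exists e.
exists (e *t w); split.
  transitivity ((e^T *t w^T) *m (e *t w)); first by rewrite -trmx_tens.
  by rewrite [LHS](tensmx_mul e^T w^T e w) ee ww tens1mx1.
by rewrite ntensmxSS [LHS](tensmx_mul Z _ e w) Ze Zw.
Qed.

(** The equation [e] lets one statement serve both for dimension 2^3 and for dimension 4^(n+1),
    which is a power of 2 only up to a cast. *)
Lemma graded_clifford_ex n m (e : (2 ^ n.+1)%N = m) :
  exists E w, graded_clifford n.+1 (castmx (e, e) (Z ^t n.+1)) E w.
Proof.
case: m / e; rewrite castmx_id.
have [w [ww Zw]] := ntens_pauliZ_vacuum n.
exists (jordan_wigner n), w; split=> //.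
- by move=> i _; exact: jordan_wigner_tr.
- by move=> i _; exact: jordan_wigner_sqr.
- exact: jordan_wigner_anti.
- exact: jordan_wigner_odd.
- exact: ntens_pauliZ_tr.
Qed.

End jordan_wigner.

(** * Square roots of positive operators *)

Section hilbert.
Variables (R : realType) (H K : hilbertType R).
Implicit Types (u v x y : H).

Lemma hdot_le u v : `|'[u, v]| <= `|u| * `|v|.
Proof. by have := dot_le hdot u v; rewrite !hdot_norm !sqrCK. Qed.

Lemma hdot_inj x y : (forall u, '[u, x] = '[u, y]) -> x = y.
Proof.
move=> xy; apply/eqP; rewrite -subr_eq0 -(dnorm_eq0 hdot).
by rewrite linearBr /= xy subrr.
Qed.

Lemma selfadjP (T : 'B(H)) : selfadj T <-> forall u v, '[T u, v] = '[u, T v].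
Proof.
split=> [T_sa u v|T_sa]; first by rewrite adjP T_sa.
by apply/bopP => v; apply: hdot_inj => u; rewrite -adjP T_sa.
Qed.

Lemma adjCP (T : 'B(H, K)) u (w : K) : '[adj T w, u] = '[w, T u].
Proof. by rewrite dotC -adjP -dotC. Qed.

Lemma Re_norm x : (complex.Re `|x|)%:C = `|x|.
Proof. by rewrite RRe_real// ger0_real. Qed.

Lemma le_norm_real x (r : R) : (`|x| <= r%:C) = (complex.Re `|x| <= r).
Proof. by rewrite -lecR Re_norm. Qed.

End hilbert.

Section sqrt_rate.
Variable R : realType.

(* The iteration y_(n+1) = (1 + y_n^2)/2 computes 1 - sqrt (1 - t) at t = 1; it
   majorises the analogous iteration for contractions. *)
Fixpoint sqrt_seq n : R := if n is m.+1 then (1 + sqrt_seq m ^+ 2) / 2 else 0.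

Lemma sqrt_seq_bound n : 0 <= sqrt_seq n <= 1.
Proof.
elim: n => [|n /andP[y0 y1]] /=; first by rewrite lexx ler01.
by move: (sqrt_seq n) y0 y1 => x x0 x1; apply/andP; split; nra.
Qed.

(** The defect e = 1 - y_n evolves by e - e^2/2, which is increasing for e <= 1. So the bound 2/q
    passes to 2/(q + 1), because (q - 1)(q + 1) <= q^2. *)
Lemma sqrt_seq_rate n : 1 - sqrt_seq n <= 2 / n.+2%:R.
Proof.
elim: n => [|n IH] /=; first by rewrite subr0 divff ?pnatr_eq0.
have /andP[] := sqrt_seq_bound n; move: (sqrt_seq n) IH => y + y0 y1.
set e := 1 - y => IH.
have -> : 1 - (1 + y ^+ 2) / 2 = e - e ^+ 2 / 2 by rewrite /e; field.
pose q : R := n.+2%:R.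
have q2 : 2 <= q by rewrite ler_nat.
have -> : n.+3%:R = q + 1 :> R by rewrite /q -natr1.
have e1 : e <= 1 by rewrite /e; lra.
have e0 : 0 <= e by rewrite /e; lra.
have q0 : 0 < q by lra.
have t1 : 2 / q <= 1 by rewrite ler_pdivrMr// mul1r.
set t := 2 / q in IH t1 *.
apply: (@le_trans _ _ (t - t ^+ 2 / 2)); first by nra.
have -> : t - t ^+ 2 / 2 = 2 * (q - 1) / q ^+ 2.
  by rewrite /t; field; lra.
rewrite ler_pdivrMr ?exprn_gt0// mulrAC ler_pdivlMr; last by lra.
by nra.
Qed.

(** Turns estimates at the rate 1 - y_n into exact equalities; the identities for the limit operator
    are all proved through it. *)
Lemma sqrt_seq_small (x : R[i]) (K : R[i]) : 0 <= x -> 0 <= K ->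
  (forall n, x <= (1 - sqrt_seq n)%:C * K) -> x = 0.
Proof.
move=> x0 K0 xK; apply/eqP; rewrite eq_le x0 andbT.
rewrite -(RRe_real (ger0_real x0)) -[0]/(0%:C) lecR leNgt; apply/negP => xp.
have Kr := RRe_real (ger0_real K0).
set r := complex.Re x in xp; set k := complex.Re K in Kr.
have rk n : r <= (1 - sqrt_seq n) * k.
  by rewrite -lecR rmorphM /= Kr /r RRe_real ?ger0_real.
have k0 : 0 <= k by rewrite -lecR Kr.
have [n nk] : exists n : nat, 2 * k / r < n%:R.
  by exists (Num.bound (2 * k / r)); rewrite archi_boundP// divr_ge0 ?mulr_ge0// ltW.
have := rk n; apply/negP; rewrite -ltNge.
have nS : (n%:R : R) <= n.+2%:R by rewrite ler_nat leqW.
have n2 : 0 < n.+2%:R :> R by [].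
apply: le_lt_trans (ler_wpM2r k0 (sqrt_seq_rate n)) _.
rewrite mulrAC ltr_pdivrMr//.
move: nk; rewrite ltr_pdivrMr// => nk; apply: lt_le_trans nk _.
by rewrite mulrC ler_wpM2l// ltW.
Qed.

End sqrt_rate.

(** * Factorisation of 1 - T for a self-adjoint contraction T *)

Section contraction_sqrt.
Variables (R : realType) (H : hilbertType R) (T : 'B(H)).
Hypothesis T_sa : forall u v, '[T u, v] = '[u, T v].
Hypothesis T_contr : forall u, `|T u| <= `|u|.
Local Notation y := (sqrt_seq R).

(** A limit L of this iteration satisfies 2 L = T + L^2, that is (1 - L)^2 = 1 - T. *)
Fixpoint sqrt_iter n : 'B(H) :=
  if n is m.+1 then 2^-1 *: (T + sqrt_iter m * sqrt_iter m) else 0.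
Local Notation Y := sqrt_iter.

Let YS n u : Y n.+1 u = 2^-1 *: (T u + Y n (Y n u)). Proof. by []. Qed.

Let half_ge0 : 0 <= 2^-1 :> R[i]. Proof. by rewrite invr_ge0. Qed.

Let half_real (r : R) : 2^-1 * r%:C = (r / 2)%:C.
Proof. by rewrite mulrC rmorphM /= fmorphV /= rmorph_nat. Qed.

Let y_ge0 n : 0 <= (y n)%:C :> R[i].
Proof. by rewrite ler0c; case/andP: (sqrt_seq_bound R n). Qed.

Let Y_sa n u v : '[Y n u, v] = '[u, Y n v].
Proof.
elim: n u v => [|n IH] u v /=; first by rewrite linear0l linear0r.
rewrite linearZl_LR linearZr_LR /= linearDl linearDr /= T_sa !IH.
by rewrite fmorphV /= conjC_nat.
Qed.

Let Y_norm n u : `|Y n u| <= (y n)%:C * `|u|.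
Proof.
elim: n u => [|n IH] u; first by rewrite /= normr0 mul0r.
rewrite YS normrZ ger0_norm// -[(y n.+1)%:C]half_real -mulrA ler_wpM2l//.
rewrite (le_trans (ler_normD _ _))// rmorphD mulrDl mul1r lerD//.
rewrite (le_trans (IH _))// rmorphXn expr2 -mulrA ler_wpM2l//.
Qed.

(** Writing A^2 - B^2 as (A - B) A + B (A - B) avoids any commutation argument. The increments of
    [sqrt_seq] obey the same recursion with equality, so they dominate. *)
Let YB_norm n u : `|Y n.+1 u - Y n u| <= (y n.+1 - y n)%:C * `|u|.
Proof.
elim: n u => [|n IH] u.
  have Y0 w : Y 0 w = 0 by [].
  rewrite YS !Y0 subr0 addr0 normrZ ger0_norm// /= expr0n addr0 subr0.
  by rewrite -half_real mulr1 ler_wpM2l.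
set z := Y n.+1 u.
have -> : Y n.+2 u - z =
    2^-1 *: ((Y n.+1 z - Y n z) + Y n (Y n.+1 u - Y n u)).
  rewrite linearB -/z (YS n.+1 u) -/z [X in _ - X](YS n u) -scalerBr; congr (_ *: _).
  by rewrite opprD addrACA subrr add0r addrA subrK.
rewrite normrZ ger0_norm//.
have -> : y n.+2 - y n.+1 =
    ((y n.+1 - y n) * y n.+1 + y n * (y n.+1 - y n)) / 2.
  by rewrite [y n.+2]/=; rewrite [y n.+1]/=; field.
have d0 : 0 <= (y n.+1 - y n)%:C :> R[i].
  by rewrite ler0c /=; move: (y n) => x; have := sqr_ge0 (x - 1); nra.
rewrite -half_real -mulrA ler_wpM2l// (le_trans (ler_normD _ _))//.
have := Y_norm n.+1 u; move: (y n.+1) IH d0 => p IH d0 up.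
rewrite rmorphD mulrDl !rmorphM -!mulrA lerD//.
  by rewrite (le_trans (IH _))// ler_wpM2l.
by rewrite (le_trans (Y_norm _ _))// ler_wpM2l// IH.
Qed.

Let e_ge0 n : 0 <= (1 - y n)%:C :> R[i].
Proof. by rewrite ler0c subr_ge0; case/andP: (sqrt_seq_bound R n). Qed.

Let Y_cauchy n m u : (n <= m)%N -> `|Y m u - Y n u| <= (1 - y n)%:C * `|u|.
Proof.
move=> /subnK <-; apply: (@le_trans _ _ ((y (m - n + n) - y n)%:C * `|u|)).
  elim: (m - n)%N => [|k IH]; first by rewrite add0n !subrr normr0 mul0r.
  rewrite addSn -(subrK (Y (k + n) u) (Y (k + n).+1 u)) -addrA.
  rewrite (le_trans (ler_normD _ _))//.
  have -> : y (k + n).+1 - y n = (y (k + n).+1 - y (k + n)) + (y (k + n) - y n).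
    by rewrite addrA subrK.
  by rewrite rmorphD mulrDl lerD// YB_norm.
rewrite ler_wpM2r// lecR lerD2r.
by case/andP: (sqrt_seq_bound R (m - n + n)).
Qed.

Let Y_lim u : exists l, forall n, `|l - Y n u| <= (1 - y n)%:C * `|u|.
Proof.
pose r := complex.Re `|u|.
have ru : r%:C = `|u| by exact: Re_norm.
have r0 : 0 <= r by rewrite -(@ler0c R) ru.
have small e : 0 < e -> \forall n \near \oo, (1 - y n) * r < e.
  move=> e0.
  (* By [sqrt_seq_rate] it suffices that 1/(n+1) lies below this threshold. The 1 added to r keeps
     the denominator positive when u = 0. *)
  have /(_ (e / (2 * (r + 1)))) small : forall d : R, 0 < d ->
      \forall n \near \oo, n.+1%:R^-1 < d.
    by move=> d /posnumP[c]; exact: near_infty_natSinv_lt.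
  have r1 : 0 < 2 * (r + 1) by lra.
  apply: filterS (small _) => [n|]; last by rewrite divr_gt0.
  rewrite ltr_pdivlMr// => ne.
  have n1 : n.+2%:R^-1 <= n.+1%:R^-1 :> R.
    by rewrite lef_pV2 ?posrE// ler_nat.
  have n0 : 0 <= n.+2%:R^-1 :> R by rewrite invr_ge0.
  have := sqrt_seq_rate R n.
  have /andP[] := sqrt_seq_bound R n; move: (y n) => x x0 x1.
  by set t := n.+2%:R^-1 in n1 n0 *; set t' := n.+1%:R^-1 in ne n1 *; nra.
have Yc : cvg ((fun n => Y n u) @ \oo).
  apply: cauchy_cvg; apply/cauchy_ballP => e e0.
  have er : 0 < complex.Re e by rewrite -ltcR RRe_real ?gtr0_real.
  rewrite near_simpl; near=> n k.
  rewrite -ball_normE /= -(RRe_real (gtr0_real e0)).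
  have ne : (1 - y n) * r < complex.Re e by near: n; exact: small.
  have ke : (1 - y k) * r < complex.Re e by near: k; exact: small.
  have [nk|/ltnW kn] := leqP n k.
    rewrite distrC (le_lt_trans (Y_cauchy u nk))// -ru -rmorphM ltcR//.
  by rewrite (le_lt_trans (Y_cauchy u kn))// -ru -rmorphM ltcR.
have /cvg_ex[l Yl] := Yc.
(* The bound on [Y m u - Y n u] for m >= n is uniform in m, so it survives the limit up to an
   arbitrary e. *)
exists l => n; rewrite -ru -rmorphM le_norm_real; apply/ler_addgt0Pr => e e0.
rewrite -le_norm_real rmorphD.
near \oo => m.
rewrite -(subrK (Y m u) l) -addrA addrC (le_trans (ler_normD _ _))// lerD//.
  have nm : (n <= m)%N by near: m; exact: nbhs_infty_ge.
  by rewrite (le_trans (Y_cauchy u nm))// -ru -rmorphM.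
apply: ltW; near: m; move/cvgrPdist_lt : Yl; apply.
by rewrite ltcR.
Unshelve. all: by end_near. Qed.

(** [D] is 1 - L with L the pointwise limit of the iteration. *)
Lemma contraction_sqrt : exists D : 'B(H),
  forall u v, '[D u, D v] = '[u - T u, v].
Proof.
have /choice[L LY] := Y_lim.
(* A vector approximated by [Y n w] at the rate 1 - y_n must be [L w]; linearity of L follows from
   this. *)
have L_uniq l w K : 0 <= K -> (forall n, `|l - Y n w| <= (1 - y n)%:C * K) ->
    l = L w.
  move=> K0 lY; apply/eqP; rewrite -subr_eq0 -normr_eq0; apply/eqP.
  apply: (@sqrt_seq_small R _ (K + `|w|)) => [//||n]; first exact: addr_ge0.
  have -> : l - L w = (l - Y n w) - (L w - Y n w).
    by rewrite opprB addrA subrK.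
  by rewrite (le_trans (ler_normB _ _))// mulrDr lerD.
have L_lin : linear L.
  move=> a u v; apply/esym.
  apply: (L_uniq _ _ (`|a| * `|u| + `|v|)) => [|n].
    by rewrite addr_ge0 ?mulr_ge0.
  rewrite linearP opprD addrACA -scalerBr (le_trans (ler_normD _ _))//.
  rewrite mulrDr lerD//; last exact: LY.
  by rewrite normrZ mulrCA ler_wpM2l// LY.
have L_norm u : `|L u| <= 1 * `|u|.
  by have := LY u 0%N; rewrite /= !subr0.
pose LT : 'B(H) := Bop (bounded_linear_bound L_lin L_norm).
exists (1 - LT) => u v.
have D n w : (1 - LT) w = (w - Y n w) - (L w - Y n w).
  by rewrite opprB addrA subrK.
apply/eqP; rewrite -subr_eq0 -normr_eq0; apply/eqP.
set D1 := 1 - LT.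
(* With d = 1 - Y_n, the three summands bound the errors from replacing [D1 u] by [d u], then [D1 v]
   by [d v], and from the defect of d^2 against 1 - T. *)
apply: (@sqrt_seq_small R _ (`|u| * `|D1 v| + 2 * `|u| * `|v| + 2 * (`|u| * `|v|))).
- by [].
- by rewrite !addr_ge0 ?mulr_ge0.
move=> n; pose d w := w - Y n w.
have dD w : `|D1 w - d w| <= (1 - y n)%:C * `|w|.
  by rewrite /d (D n) addrAC subrr sub0r normrN.
have d2 w : `|d w| <= 2 * `|w|.
  rewrite (le_trans (ler_normB _ _))// mulrDl mul1r lerD//.
  rewrite (le_trans (Y_norm _ _))// ler_piMl// -[1]/(1%:C) lecR.
  by case/andP: (sqrt_seq_bound R n).
(* Since Y_n^2 = 2 Y_(n+1) - T, the square of 1 - Y_n is 1 - T + 2 (Y_(n+1) - Y_n). *)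
have dd : '[d u, d v] = '[u - T u, v] + 2 * '[Y n.+1 u - Y n u, v].
  rewrite YS /d !linearBl !linearBr linearZl_LR linearDl /= -!Y_sa.
  by field.
have -> : '[D1 u, D1 v] - '[u - T u, v] =
    '[D1 u - d u, D1 v] + '[d u, D1 v - d v] + 2 * '[Y n.+1 u - Y n u, v].
  have -> : 2 * '[Y n.+1 u - Y n u, v] = '[d u, d v] - '[u - T u, v].
    by rewrite dd addrAC subrr add0r.
  by move: (d u) (d v) => p s; rewrite !linearBl !linearBr /=; ring.
rewrite (le_trans (ler_normD _ _))// mulrDr lerD//.
  rewrite (le_trans (ler_normD _ _))// mulrDr lerD//.
    by rewrite (le_trans (hdot_le _ _))// mulrA ler_wpM2r.
  rewrite (le_trans (hdot_le _ _))//.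
  rewrite [leRHS]mulrCA; apply: ler_pM => //.
rewrite normrM normr_nat [leRHS]mulrCA ler_wpM2l//.
rewrite (le_trans (hdot_le _ _))// mulrA ler_wpM2r//.
exact: Y_cauchy.
Qed.

End contraction_sqrt.

Section positive_sqrt.
Variables (R : realType) (H : hilbertType R).

(** For c = |M| + 1, which is positive even when M = 0, the operator T = 1 - M/c is a contraction
    with 1 - T = M/c. A factor of 1 - T is then rescaled by the square root of c. *)
Lemma positive_sqrt (M : 'B(H)) :
  selfadj M -> (forall u, 0 <= '[M u, u]) ->
  exists D : 'B(H), forall u v, '[D u, D v] = '[M u, v].
Proof.
move=> /selfadjP M_sa M_ge0.
pose c : R[i] := `|M| + 1.
have c0 : 0 < c by rewrite ltr_wpDl.
have cR : c^-1 \is Num.real by rewrite realV gtr0_real.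
have cJ : (c^-1)^* = c^-1 by apply/CrealP.
(* Positivity of M at u - M u/c, combined with s <= c q for the second-order term, leaves q <= c p.
   This makes T a contraction. *)
have M_norm u : `|M u| ^+ 2 <= c * '[M u, u].
  have [Mu0|Mu0] := eqVneq `|M u| 0.
    by rewrite Mu0 expr0n /= mulr_ge0// ltW.
  have := M_ge0 (u - c^-1 *: M u).
  have -> : M (u - c^-1 *: M u) = M u - c^-1 *: M (M u).
    by rewrite linearB linearZ.
  rewrite linearBl !linearBr /= !linearZl_LR !linearZr_LR /=.
  rewrite cJ (M_sa (M u) u) -!hdot_norm.
  set q := '[M u, M u]; set p := '[M u, u]; set s := '[M (M u), M u] => h.
  have sq : s <= c * q.
    have sr : 0 <= s by exact: M_ge0.
    rewrite -(ger0_norm sr) (le_trans (hdot_le _ _))//.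
    rewrite /q hdot_norm expr2 mulrA ler_wpM2r// (le_trans (le_opnorm M _))//.
    by rewrite ler_wpM2r// /c lerDl.
  have h' : 0 <= p - c^-1 * q - c^-1 * q + c^-1 * (c^-1 * (c * q)).
    apply: le_trans h _.
    have -> : p - c^-1 * q - (c^-1 * q - c^-1 * (c^-1 * s)) =
      p - c^-1 * q - c^-1 * q + c^-1 * (c^-1 * s) by ring.
    by rewrite lerD2l ler_wpM2l ?invr_ge0 ?(ltW c0)// ler_wpM2l ?invr_ge0 ?(ltW c0).
  move: h'; have -> : p - c^-1 * q - c^-1 * q + c^-1 * (c^-1 * (c * q)) =
      p - c^-1 * q by field; rewrite gt_eqF.
  by rewrite subr_ge0 ler_pdivrMl.
pose T : 'B(H) := 1 - c^-1 *: M.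
have T_sa u v : '[T u, v] = '[u, T v].
  by rewrite /T linearBl linearBr /= linearZl_LR linearZr_LR /= cJ M_sa.
have T_contr u : `|T u| <= `|u|.
  rewrite -(@ler_pXn2r _ 2)// ?nnegrE// -!hdot_norm /T.
  rewrite linearBl !linearBr /= !linearZl_LR !linearZr_LR /= cJ -M_sa.
  rewrite -[leRHS]addr0 -addrA lerD2l.
  have -> : - (c^-1 * '[M u, u]) - (c^-1 * '[M u, u] - c^-1 * (c^-1 * '[M u, M u])) =
    c^-1 * (c^-1 * '[M u, M u] - '[M u, u] - '[M u, u]) by ring.
  rewrite pmulr_rle0 ?invr_gt0//.
  rewrite -[leRHS](addr0 0) lerD ?oppr_le0//.
  by rewrite hdot_norm subr_le0 ler_pdivrMl.
have [D DT] := contraction_sqrt T_sa T_contr.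
exists (sqrtC c *: D) => u v.
have sc : (sqrtC c)^* = sqrtC c by apply/CrealP/ger0_real; rewrite sqrtC_ge0 ltW.
rewrite /= linearZl_LR linearZr_LR /= sc DT mulrA -expr2 sqrtCK.
rewrite /T /= opprB addrC subrK linearZl_LR /= mulrA divff ?mul1r//.
by rewrite gt_eqF.
Qed.

End positive_sqrt.

(** * Vacuum expectation values of products of generators *)

Section clifford_vectors.
Variables (R : realType) (m n : nat) (Z : 'M[R]_m) (E : nat -> 'M[R]_m).
Variable w : 'cV[R]_m.
Hypothesis C : graded_clifford n Z E w.

Lemma mx_eq_opp p q (A : 'M[R]_(p, q)) : A = - A -> A = 0.
Proof.
move=> /matrixP AN; apply/matrixP => i j; have := AN i j; rewrite !mxE.
by move: (A i j) => a; lra.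
Qed.

(** The grading fixes [w], so it can be inserted on the left of [A] and absorbed on the right, at
    the cost of a sign. *)
Lemma odd_vacuum A : Z *m A = - (A *m Z) -> w^T *m A *m w = 0.
Proof.
move=> ZA; apply: mx_eq_opp.
have wZ : w^T *m Z = w^T by rewrite -{2}(gc_even C) trmx_mul (gc_Ztr C).
by rewrite -{1}wZ -(mulmxA _ Z) ZA mulmxN mulNmx !mulmxA -(mulmxA _ Z) (gc_even C).
Qed.

Lemma clifford_vacuum i : (i < n)%N -> w^T *m E i *m w = 0.
Proof. by move=> ilt; apply: odd_vacuum; exact: (gc_odd C). Qed.

(** For distinct indices, a 1 by 1 matrix equals its transpose, but transposing reverses the product
    and anticommutation changes its sign. *)
Lemma clifford2_vacuum i j : (i < n)%N -> (j < n)%N ->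
  w^T *m (E i *m E j) *m w = (i == j)%:R%:M.
Proof.
move=> ilt jlt; have [->|ij] := eqVneq i j.
  by rewrite (gc_sqr C)// mulmx1 (gc_unit C).
rewrite raddf0; apply: mx_eq_opp.
have tr1 (A : 'M[R]_1) : A^T = A.
  by apply/matrixP => x y; rewrite !ord1 mxE.
rewrite -{1}[LHS]tr1 !trmx_mul trmxK !(gc_tr C)// (gc_anti C)// 1?eq_sym//.
by rewrite mulNmx mulmxN mulmxA.
Qed.

Lemma clifford3_vacuum i j k : (i < n)%N -> (j < n)%N -> (k < n)%N ->
  w^T *m (E i *m E j *m E k) *m w = 0.
Proof.
move=> ilt jlt klt; apply: odd_vacuum.
rewrite !mulmxA (gc_odd C ilt) !mulNmx -!mulmxA; congr (- _).
rewrite (mulmxA Z) (gc_odd C jlt) mulNmx mulmxN -mulmxA (gc_odd C klt).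
by rewrite !mulmxN opprK.
Qed.

(* The columns of F and of E 0 *m F span the module generated by w. *)
Lemma clifford_fixed_pair : (1 < n)%N ->
  exists F : 'M[R]_(m, 2), F^T *m F = 1%:M /\ E 1 *m F = F.
Proof.
move=> n1; have n0 : (0 < n)%N by exact: ltnW.
pose G : 'M[R]_(m, 1 + 1) := row_mx w (E 0 *m w).
have GAG A : G^T *m A *m G = block_mx (w^T *m A *m w) (w^T *m (A *m E 0) *m w)
    (w^T *m (E 0 *m A) *m w) (w^T *m (E 0 *m A *m E 0) *m w).
  rewrite /G tr_row_mx mul_col_mx mul_col_row trmx_mul (gc_tr C)//.
  by rewrite !mulmxA.
have GG : G^T *m G = 1%:M.
  rewrite -[G^T]mulmx1 GAG !mulmx1 !mul1mx (gc_unit C) (gc_sqr C)// mulmx1.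
  by rewrite clifford_vacuum// (gc_unit C) scalar_mx_block.
(* Because [E 1] compresses to 0 on the orthonormal columns of G, the projection (1 + E 1)/2 halves
   their Gram matrix; the factor [r] below restores the norm. *)
have GEG : G^T *m E 1 *m G = 0.
  rewrite GAG clifford_vacuum// !clifford2_vacuum// clifford3_vacuum//=.
  by rewrite raddf0 block_mx0.
pose r : R := Num.sqrt 2^-1.
have rr : r * r = 2^-1 by rewrite -expr2 sqr_sqrtr// invr_ge0.
exists (r *: ((1%:M + E 1) *m G)); split; last first.
  by rewrite -scalemxAr mulmxA mulmxDr mulmx1 (gc_sqr C)// addrC.
have -> (B : 'M_(m, 2)) : (r *: B)^T *m (r *: B) = 2^-1 *: (B^T *m B).
  by rewrite [(r *: B)^T]linearZ -scalemxAr -scalemxAl scalerA rr.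
rewrite trmx_mul [(_ + _)^T]linearD /= trmx1 (gc_tr C)// mulmxA -(mulmxA _ _ (1%:M + E 1)).
have -> : (1%:M + E 1) *m (1%:M + E 1) = 2 *: (1%:M + E 1).
  by rewrite mulmxDr mulmx1 mulmxDl mul1mx (gc_sqr C)// scaler_nat mulr2n [E 1 + _]addrC.
rewrite -scalemxAr -scalemxAl scalerA mulVf// scale1r.
by rewrite mulmxDr mulmxDl GEG addr0 mulmx1 GG.
Qed.

End clifford_vectors.

(** * Compressions of Clifford generators *)

Section amplification.
Variables (R : realType) (H : hilbertType R).

(* The operator 1 (x) F : H (x) C^r -> H (x) C^m for a real matrix F. *)
Definition ampl m r (F : 'M[R]_(m, r)) (u : htens H r) : htens H m :=
  [ffun k => \sum_l (F k l)%:C *: u l].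

(** The elementary tensor x (x) f for a real vector f. *)
Definition htens_vec m (f : 'cV[R]_m) (x : H) : htens H m :=
  [ffun k => (f k 0)%:C *: x].

Lemma htens_dotE m (u v : htens H m) : '[u, v] = \sum_i '[u i, v i].
Proof. by []. Qed.

Lemma Num_conj_real (t : R) : Num.conj (t%:C) = t%:C.
Proof. exact: conjc_real. Qed.

Lemma ampl_linear m r (F : 'M[R]_(m, r)) : linear (ampl F).
Proof.
move=> a u v; apply/ffunP => k; rewrite !ffunE scaler_sumr -big_split /=.
by apply: eq_bigr => l _; rewrite !ffunE scalerDr !scalerA mulrC.
Qed.

HB.instance Definition _ m r (F : 'M[R]_(m, r)) :=
  GRing.isLinear.Build R[i] (htens H r) (htens H m) *:%R (ampl F)
    (@ampl_linear m r F).

Lemma htens_vec_linear m (f : 'cV[R]_m) : linear (htens_vec f).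
Proof.
move=> a u v; apply/ffunP => k; rewrite !ffunE.
by rewrite scalerDr !scalerA mulrC.
Qed.

HB.instance Definition _ m (f : 'cV[R]_m) :=
  GRing.isLinear.Build R[i] H (htens H m) *:%R (htens_vec f)
    (@htens_vec_linear m f).

Lemma ampl_mul m r s (F : 'M[R]_(m, r)) (G : 'M[R]_(r, s)) u :
  ampl F (ampl G u) = ampl (F *m G) u.
Proof.
apply/ffunP => k; rewrite !ffunE.
under eq_bigr do rewrite ffunE scaler_sumr.
rewrite exchange_big; apply: eq_bigr => l _.
rewrite mxE rmorph_sum scaler_suml; apply: eq_bigr => i _.
by rewrite scalerA rmorphM.
Qed.

Lemma ampl1 m (u : htens H m) : ampl 1%:M u = u.
Proof.
apply/ffunP => k; rewrite ffunE (bigD1 k)//= mxE eqxx scale1r big1 ?addr0//.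
by move=> l /negPf lk; rewrite mxE eq_sym lk scale0r.
Qed.

Lemma amplN m r (F : 'M[R]_(m, r)) u : ampl (- F) u = - ampl F u.
Proof.
apply/ffunP => k; rewrite !ffunE -sumrN; apply: eq_bigr => l _.
by rewrite mxE rmorphN scaleNr.
Qed.

Lemma ampl0 m r u : ampl (0 : 'M[R]_(m, r)) u = 0.
Proof.
apply/ffunP => k; rewrite !ffunE big1// => l _.
by rewrite mxE scale0r.
Qed.

Lemma ampl_adj m r (F : 'M[R]_(m, r)) u v : '[ampl F u, v] = '[u, ampl F^T v].
Proof.
rewrite !htens_dotE.
under eq_bigr do rewrite ffunE linear_sumlz.
under [RHS]eq_bigr do rewrite ffunE linear_sumr.
rewrite exchange_big; apply: eq_bigr => l _; apply: eq_bigr => k _.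
by rewrite linearZl_LR linearZr_LR /= mxE Num_conj_real.
Qed.

Lemma ampl_vec m r (F : 'M[R]_(m, r)) f x :
  ampl F (htens_vec f x) = htens_vec (F *m f) x.
Proof.
apply/ffunP => k; rewrite !ffunE mxE rmorph_sum scaler_suml.
by apply: eq_bigr => l _; rewrite ffunE scalerA rmorphM.
Qed.

Lemma htens_vec_dot m (f g : 'cV[R]_m) x y :
  '[htens_vec f x, htens_vec g y] = ((f^T *m g) 0 0)%:C * '[x, y].
Proof.
rewrite htens_dotE mxE rmorph_sum mulr_suml; apply: eq_bigr => k _.
rewrite !ffunE linearZl_LR linearZr_LR /= Num_conj_real mxE rmorphM /=; ring.
Qed.

End amplification.

Section compression.
Variables (R : realType) (H : hilbertType R).

Lemma isometry_bop (L : hilbertType R) (V : {linear H -> L}) :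
  (forall u v, '[V u, V v] = '[u, v]) ->
  exists V' : 'B(H, L), V' =1 V.
Proof.
move=> V_iso.
have V_norm u : `|V u| <= 1 * `|u|.
  by rewrite mul1r -(@ler_pXn2r _ 2)// ?nnegrE// -!hdot_norm V_iso.
have V_lin : linear V by move=> a u v; rewrite linearP.
by exists (Bop (bounded_linear_bound V_lin V_norm)).
Qed.

Lemma hdot_suml (K : hilbertType R) N (f : 'I_N -> K) v :
  '[\sum_i f i, v] = \sum_i '[f i, v].
Proof. exact: linear_sumlz. Qed.

Lemma hdot_sumr (K : hilbertType R) N (f : 'I_N -> K) u :
  '[u, \sum_i f i] = \sum_i '[u, f i].
Proof. exact: linear_sumr. Qed.

Lemma htens_vec_dot_sum m N (f g : 'cV[R]_m) (F G : 'I_N -> 'cV[R]_m)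
    (a c : H) (b e : 'I_N -> H) :
  '[htens_vec f a + \sum_i htens_vec (F i) (b i),
    htens_vec g c + \sum_j htens_vec (G j) (e j)] =
  (((f^T *m g) 0 0)%:C * '[a, c] +
   \sum_j ((f^T *m G j) 0 0)%:C * '[a, e j]) +
  (\sum_i (((F i)^T *m g) 0 0)%:C * '[b i, c] +
   \sum_i \sum_j (((F i)^T *m G j) 0 0)%:C * '[b i, e j]).
Proof.
rewrite linearDl !linearDr /= !hdot_suml !hdot_sumr !htens_vec_dot.
congr (_ + _ + (_ + _)); apply: eq_bigr => i _; rewrite ?hdot_sumr ?htens_vec_dot//.
by apply: eq_bigr => j _; rewrite htens_vec_dot.
Qed.

(** The Kronecker delta is wrapped in a 1 by 1 matrix, as [clifford2_vacuum] produces it. *)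
Lemma sum_delta N (k : 'I_N) (F : 'I_N -> R[i]) :
  \sum_i (((k == i)%:R%:M : 'M[R]_1) 0 0)%:C * F i = F k.
Proof.
rewrite (bigD1 k)//= eqxx mxE mul1r big1 ?addr0// => i /negPf ik.
by rewrite eq_sym ik raddf0 mxE mul0r.
Qed.

(** In the compression of [E k] only the two cross terms between w and E_k w survive, the others
    being odd. The result is symmetrised since the defect operator, one of the [Y i] in the
    application, comes without self-adjointness. *)
Lemma clifford_compression m n N (Z : 'M[R]_m) E w (Y : 'I_N -> 'B(H)) :
  graded_clifford n Z E w -> (N <= n)%N ->
  (forall u v, \sum_i '[Y i u, Y i v] = '[u, v]) ->
  exists V : 'B(H, htens H m), (forall u v, '[V u, V v] = '[u, v]) /\
    forall (k : 'I_N) u v,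
      '[ampl (E k) (V u), V v] = 2^-1 * ('[Y k u, v] + '[u, Y k v]).
Proof.
move=> C Nn YY.
have lt_n (i : 'I_N) : (i < n)%N by exact: leq_trans (ltn_ord i) Nn.
pose V0 (u : H) := htens_vec w u + \sum_(i < N) htens_vec (E i *m w) (Y i u).
pose r : R := Num.sqrt 2^-1.
have rr : r%:C * r%:C = 2^-1 :> R[i].
  by rewrite -rmorphM -expr2 sqr_sqrtr ?invr_ge0// fmorphV /= rmorph_nat.
pose V u := r%:C *: V0 u.
have V_lin : linear V.
  move=> a u v; rewrite /V /V0 scalerA mulrC -scalerA -scalerDr; congr (_ *: _).
  rewrite linearP scalerDr scaler_sumr addrACA; congr (_ + _).
  by rewrite -big_split; apply: eq_bigr => i _ /=; rewrite !linearP.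
have dotV A u v : '[ampl A (V u), V v] = 2^-1 * '[ampl A (V0 u), V0 v].
  rewrite /V [ampl A _]linearZ /= linearZl_LR linearZr_LR /= Num_conj_real mulrA.
  by rewrite rr.
have dot1 u v : '[V0 u, V0 v] = 2 * '[u, v].
  rewrite htens_vec_dot_sum (gc_unit C) mxE mul1r.
  rewrite big1 => [|j _]; last first.
    by rewrite mulmxA (clifford_vacuum C)// mxE mul0r.
  rewrite [X in _ + (X + _)]big1 => [|i _]; last first.
    by rewrite trmx_mul (gc_tr C)// (clifford_vacuum C)// mxE mul0r.
  rewrite -YY addr0 add0r mulr_natl mulr2n; congr (_ + _).
  apply: eq_bigr => i _; rewrite -[RHS](sum_delta i (fun j => '[Y i u, Y j v])).
  apply: eq_bigr => j _; rewrite trmx_mul (gc_tr C)// -mulmxA (mulmxA (E i)).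
  by rewrite mulmxA (clifford2_vacuum C).
have dotE (k : 'I_N) u v : '[ampl (E k) (V0 u), V0 v] = '[Y k u, v] + '[u, Y k v].
  have -> : ampl (E k) (V0 u) = htens_vec (E k *m w) u +
      \sum_(i < N) htens_vec (E k *m (E i *m w)) (Y i u).
    rewrite /V0 linearD linear_sum /= ampl_vec; congr (_ + _).
    by apply: eq_bigr => i _; rewrite ampl_vec.
  rewrite htens_vec_dot_sum trmx_mul (gc_tr C)// (clifford_vacuum C)// mxE.
  rewrite mul0r add0r addrC; congr (_ + _).
    rewrite [X in _ + X]big1 => [|i _]; last first.
      rewrite big1// => j _; rewrite !trmx_mul !(gc_tr C)// mulmxA.
      by rewrite -(mulmxA w^T) -(mulmxA w^T) (clifford3_vacuum C)// mxE mul0r.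
    rewrite addr0 -[RHS](sum_delta k (fun i => '[Y i u, v])).
    apply: eq_bigr => i _; rewrite !trmx_mul !(gc_tr C)// -(mulmxA w^T).
    by rewrite (clifford2_vacuum C)// [in RHS]eq_sym.
  rewrite -[RHS](sum_delta k (fun i => '[u, Y i v])).
  apply: eq_bigr => i _; rewrite -mulmxA (mulmxA (E k)) mulmxA.
  by rewrite (clifford2_vacuum C).
pose VL : {linear H -> htens H m} :=
  HB.pack_for {linear H -> htens H m} V (GRing.isLinear.Build _ _ _ _ V V_lin).
have VV u v : '[V u, V v] = '[u, v].
  by rewrite -[V u]ampl1 dotV ampl1 dot1 mulrA mulVf ?mul1r.
have [V' V'E] := @isometry_bop _ VL VV.
exists V'; split=> [u v|k u v]; rewrite !V'E; first exact: VV.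
by rewrite dotV dotE.
Qed.

(* With Q = (1 + E1)/2, the map x (x) e_k |-> Q E0^k V0 x determines the
   compression of the algebra generated by E0 and E1; replacing it by its modulus
   on H (x) C^2 removes the dependence on the size of L. *)
Lemma clifford2_compression (L : hilbertType R) (E0 E1 : 'B(L))
    (V0 : 'B(H, L)) m n (Z : 'M[R]_m) E w :
  selfadj E0 -> selfadj E1 -> E0 * E0 = 1 -> E1 * E1 = 1 ->
  E0 * E1 = - (E1 * E0) -> (forall u v, '[V0 u, V0 v] = '[u, v]) ->
  graded_clifford n Z E w -> (1 < n)%N ->
  exists V : 'B(H, htens H m), [/\ forall u v, '[V u, V v] = '[u, v],
    forall u v, '[ampl (E 0) (V u), V v] = '[E0 (V0 u), V0 v] &
    forall u v, '[ampl (E 1) (V u), V v] = '[E1 (V0 u), V0 v]].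
Proof.
move=> /selfadjP E0_sa /selfadjP E1_sa /bopP E00 /bopP E11 /bopP E01 V0_iso.
move=> C n1; have n0 : (0 < n)%N by exact: ltnW.
have {}E00 x : E0 (E0 x) = x by exact: E00.
have {}E11 x : E1 (E1 x) = x by exact: E11.
have {}E01 x : E0 (E1 x) = - E1 (E0 x) by exact: E01.
pose Q x := 2^-1 *: (x + E1 x) : L.
pose Qb : 'B(L) := 2^-1 *: (1 + E1).
pose pr (k : 'I_2) : 'B(htens H 2, H) := Bop (@htens_proj_subproof R H 2 k).
pose G : 'B(htens H 2, L) :=
  bcomp Qb (bcomp V0 (pr 0) + bcomp E0 (bcomp V0 (pr 1))).
have GE x : G x = Q (V0 (x 0) + E0 (V0 (x 1))) by [].
pose M := bcomp (adj G) G.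
have ME x y : '[M x, y] = '[G x, G y] by rewrite /M /= adjCP.
have M_sa : selfadj M.
  by apply/selfadjP => x y; rewrite ME dotC -ME -dotC.
have M_ge0 x : 0 <= '[M x, x] by rewrite ME dnorm_ge0.
have [D DM] := positive_sqrt M_sa M_ge0.
(* [p u] and [q u] replace Q V0 u and Q E0 V0 u inside H (x) C^2, with the same inner products. *)
pose p (u : H) := D (htens_inj (0 : 'I_2) u).
pose q (u : H) := D (htens_inj (1 : 'I_2) u).
have Gp u : G (htens_inj (0 : 'I_2) u) = Q (V0 u).
  by rewrite GE !ffunE /= !linear0 addr0.
have Gq u : G (htens_inj (1 : 'I_2) u) = Q (E0 (V0 u)).
  by rewrite GE !ffunE /= !linear0 add0r.
have Q_dot x y : '[Q x, Q y] = 2^-1 * ('[x, y] + '[E1 x, y]).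
  rewrite /Q linearZl_LR linearZr_LR /= fmorphV /= conjC_nat linearDl !linearDr /=.
  rewrite -!E1_sa E11; by field.
have pp u v : '[p u, p v] = 2^-1 * ('[u, v] + '[E1 (V0 u), V0 v]).
  by rewrite DM ME !Gp Q_dot V0_iso.
have qq u v : '[q u, q v] = 2^-1 * ('[u, v] - '[E1 (V0 u), V0 v]).
  by rewrite DM ME !Gq Q_dot -!E0_sa E00 V0_iso E01 linearNl /= E00.
(* The [E0 * E1] terms of [pq] and [qp] are opposite; they cancel in the compression of [E 0]. *)
have pq u v : '[p u, q v] = 2^-1 * ('[E0 (V0 u), V0 v] + '[E0 (E1 (V0 u)), V0 v]).
  by rewrite DM ME Gp Gq Q_dot -!E0_sa.
have qp u v : '[q u, p v] = 2^-1 * ('[E0 (V0 u), V0 v] - '[E0 (E1 (V0 u)), V0 v]).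
  by rewrite DM ME Gp Gq Q_dot E01 linearNl /= opprK.
have [F [FF E1F]] := clifford_fixed_pair C n1.
(* Modelled on x = Q x + E0 Q (E0 x). The columns of F and [E 0 *m F] lie in the eigenspaces of
   [E 1] for 1 and -1, and [E 0] exchanges them. *)
pose V u := ampl F (p u) + ampl (E 0 *m F) (q u).
have p_lin : linear p.
  move=> a u v; rewrite /p -linearP; congr (D _).
  apply/ffunP => k; rewrite !ffunE.
  by case: eqP => // _; rewrite scaler0 addr0.
have q_lin : linear q.
  move=> a u v; rewrite /q -linearP; congr (D _).
  apply/ffunP => k; rewrite !ffunE.
  by case: eqP => // _; rewrite scaler0 addr0.
have V_lin : linear V.
  move=> a u v; rewrite /V p_lin q_lin !linearP /= scalerDr.
  by rewrite addrACA.
have E1E0F : E 1 *m (E 0 *m F) = - (E 0 *m F).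
  by rewrite mulmxA (gc_anti C)// mulNmx -mulmxA E1F.
have E0E0F : E 0 *m (E 0 *m F) = F by rewrite mulmxA (gc_sqr C)// mul1mx.
have E0F_tr : (E 0 *m F)^T = F^T *m E 0 by rewrite trmx_mul (gc_tr C).
have FE0F : F^T *m E 0 *m F = 0.
  have FE1 : F^T *m E 1 = F^T by rewrite -{2}E1F trmx_mul (gc_tr C).
  have h : F^T *m E 0 *m F = F^T *m (E 0 *m E 1) *m F by rewrite -!mulmxA E1F.
  apply: mx_eq_opp; rewrite {1}h (gc_anti C)// mulmxN mulNmx.
  by rewrite (mulmxA F^T) FE1.
have amplF_dot (A B : 'M[R]_(m, 2)) x y : '[ampl A x, ampl B y] = '[x, ampl (A^T *m B) y].
  by rewrite ampl_adj ampl_mul.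
have FF0 : (E 0 *m F)^T *m (E 0 *m F) = 1%:M.
  by rewrite E0F_tr -mulmxA E0E0F.
have F0F : (E 0 *m F)^T *m F = 0 by rewrite E0F_tr.
have FE0F' : F^T *m (E 0 *m F) = 0 by rewrite mulmxA.
have dotV x y z t : '[ampl F x + ampl (E 0 *m F) y, ampl F z + ampl (E 0 *m F) t] =
    '[x, z] + '[y, t].
  rewrite linearDl !linearDr /= !amplF_dot FF FF0 F0F FE0F' !ampl0 !ampl1.
  by rewrite !linear0r addr0 add0r.
pose VL : {linear H -> htens H m} :=
  HB.pack_for {linear H -> htens H m} V (GRing.isLinear.Build _ _ _ _ V V_lin).
have VV u v : '[V u, V v] = '[u, v].
  by rewrite /V dotV pp qq; field.
have [V' V'E] := @isometry_bop _ VL VV.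
exists V'; split=> u v; rewrite !V'E; first exact: VV.
  rewrite /= /V linearD /= !ampl_mul E0E0F addrC dotV pq qp.
  by field.
rewrite /= /V linearD /= !ampl_mul E1F E1E0F amplN -linearN dotV.
rewrite pp linearNl /= qq; by field.
Qed.

End compression.

(** * Algebra, adjoints and norms of the operators W (x) M *)

Section optens_theory.
Variables (R : realType) (H : hilbertType R) (m : nat).
Implicit Types (W T : 'B(H)) (M N : 'M[R[i]]_m) (F : 'M[R]_m).

Definition complexmx (F : 'M[R]_m) : 'M[R[i]]_m := map_mx (real_complex R) F.

Lemma optens1E F u : optens (1 : 'B(H)) (complexmx F) u = ampl F u.
Proof. by apply/ffunP => k; rewrite !ffunE; apply: eq_bigr => l _; rewrite mxE. Qed.

Lemma optens_mul W T M N : optens W M * optens T N = optens (W * T) (M *m N).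
Proof.
apply/bopP => u; apply/ffunP => k; rewrite !ffunE.
under eq_bigr do rewrite ffunE linear_sum scaler_sumr.
rewrite exchange_big; apply: eq_bigr => l _.
rewrite mxE scaler_suml; apply: eq_bigr => i _.
by rewrite linearZ /= scalerA.
Qed.

Lemma optensNl W M : optens (- W) M = - optens W M.
Proof.
apply/bopP => u; apply/ffunP => k; rewrite !ffunE -sumrN.
by apply: eq_bigr => l _; rewrite -scalerN.
Qed.

Lemma optensNr W M : optens W (- M) = - optens W M.
Proof.
apply/bopP => u; apply/ffunP => k; rewrite !ffunE -sumrN.
by apply: eq_bigr => l _; rewrite mxE scaleNr.
Qed.

Lemma optens_selfadj W F : selfadj W -> F^T = F -> selfadj (optens W (complexmx F)).
Proof.
move=> /selfadjP W_sa F_sym; apply/selfadjP => u v; rewrite !htens_dotE.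
under eq_bigr do rewrite ffunE hdot_suml.
under [RHS]eq_bigr do rewrite ffunE hdot_sumr.
rewrite exchange_big; apply: eq_bigr => l _; apply: eq_bigr => k _.
rewrite linearZl_LR linearZr_LR /= W_sa -{2}F_sym !mxE.
by rewrite Num_conj_real.
Qed.

Lemma optens_1inj W l u :
  optens W (complexmx 1%:M) (htens_inj l u) = htens_inj l (W u).
Proof.
apply/ffunP => k; rewrite !ffunE (bigD1 k)//= !mxE eqxx scale1r ffunE.
rewrite big1 ?addr0 => [|j /negPf jk].
  by case: eqP => // _; rewrite linear0.
by rewrite !mxE eq_sym jk rmorph0 scale0r.
Qed.

Lemma htens_inj_dot (l : 'I_m) (u v : H) :
  '[htens_inj l u, htens_inj l v] = '[u, v].
Proof.
rewrite htens_dotE (bigD1 l)//= !ffunE eqxx big1 ?addr0// => k /negPf kl.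
by rewrite !ffunE kl linear0l.
Qed.

Lemma optens1_norm (W : 'B(H)) : `|W| <= 1 -> `|optens W (complexmx 1%:M)| <= 1.
Proof.
move=> W1; apply: opnorm_le => // u; rewrite mul1r.
rewrite -(@ler_pXn2r _ 2)// ?nnegrE// -!hdot_norm !htens_dotE ler_sum// => k _.
rewrite ffunE (bigD1 k)//= !mxE eqxx scale1r big1 ?addr0 => [|l /negPf lk].
  rewrite !hdot_norm lerXn2r ?nnegrE// (le_trans (le_opnorm W _))//.
  by rewrite ler_piMl.
by rewrite !mxE eq_sym lk rmorph0 scale0r.
Qed.

Lemma optens_clifford_norm F (a : R) : 0 <= a -> F^T *m F = (a ^+ 2)%:M ->
  `|optens (1 : 'B(H)) (complexmx F)| <= a%:C.
Proof.
move=> a0 FF; apply: opnorm_le => [|u]; first by rewrite ler0c.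
have a0' : 0 <= a%:C :> R[i] by rewrite ler0c.
rewrite -(@ler_pXn2r _ 2)// ?nnegrE ?mulr_ge0// exprMn -!hdot_norm optens1E.
rewrite ampl_adj ampl_mul FF -scalemx1.
have -> : ampl ((a ^+ 2) *: 1%:M) u = (a ^+ 2)%:C *: u.
  rewrite -[in RHS](ampl1 u); apply/ffunP => k; rewrite !ffunE scaler_sumr.
  by apply: eq_bigr => l _; rewrite mxE scalerA rmorphM.
by rewrite linearZr_LR /= Num_conj_real rmorphXn.
Qed.

End optens_theory.

Section real_cstar.
Variables (R : realType) (H : hilbertType R) (d : nat) (X : 'I_d -> 'B(H)).

(** For d >= 2 every block entry of the dilation has this form, the matrices E_j being real. *)
Lemma real_cstar_gen_scalar (t : R) : real_cstar_gen X (t%:C *: (1 : 'B(H))).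
Proof. by move=> S [SC _]; apply: rcs_scale => //; exact: rcs_one. Qed.

Lemma real_cstar_gen_mem (t : R) j : real_cstar_gen X (t%:C *: X j).
Proof. by move=> S [SC XS]; apply: rcs_scale => //; apply: XS; exists j. Qed.

Lemma dilation_compression (L : hilbertType R) (A : 'I_d -> 'B(L)) (V : 'B(H, L)) :
  (forall u v, '[V u, V v] = '[u, v]) ->
  (forall j u v, '[A j (V u), V v] = '[X j u, v]) -> dilation X A.
Proof.
move=> V_iso AX; exists V => [u|j].
  by apply/eqP; rewrite -(@eqrXn2 _ 2)// -!hdot_norm V_iso.
by apply/bopP => u; apply: hdot_inj => v; rewrite -adjP dotC -AX -dotC.
Qed.

End real_cstar.

(** * Clifford dilations of tuples with square-summable norm bounds *)

Section contraction_tuples.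
Variables (R : realType) (H : hilbertType R).

(** The bounds make T = \sum_j Y_j^2 a self-adjoint contraction, and S is the factor of 1 - T. *)
Lemma row_contraction_defect d (Y : 'I_d -> 'B(H)) (c : 'I_d -> R) :
  (forall j, selfadj (Y j)) -> (forall j, `|Y j| <= (c j)%:C) ->
  \sum_j c j ^+ 2 <= 1 ->
  exists S : 'B(H), forall u v,
    '[S u, S v] + \sum_j '[Y j u, Y j v] = '[u, v].
Proof.
move=> Y_sa Y_norm c1; pose T : 'B(H) := \sum_j Y j * Y j.
have TE u : T u = \sum_j Y j (Y j u).
  rewrite /T; elim/big_ind2 : _ => [//|A x B y <- <-//|//].
have T_dot u v : '[T u, v] = \sum_j '[Y j u, Y j v].
  rewrite TE hdot_suml; apply: eq_bigr => j _.
  by have /selfadjP-> := Y_sa j.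
have T_sa u v : '[T u, v] = '[u, T v].
  rewrite T_dot TE hdot_sumr; apply: eq_bigr => j _.
  by have /selfadjP-> := Y_sa j.
have T_norm u : `|T u| <= `|u|.
  rewrite TE (le_trans (ler_norm_sum _ _ _))//.
  apply: (@le_trans _ _ (\sum_j (c j ^+ 2)%:C * `|u|)).
    apply: ler_sum => j _.
    have Yc x : `|Y j x| <= (c j)%:C * `|x|.
      by rewrite (le_trans (le_opnorm _ _))// ler_wpM2r//; exact: Y_norm.
    rewrite (le_trans (Yc _))// rmorphXn expr2 -mulrA ler_wpM2l//.
    by rewrite (le_trans _ (Y_norm j)).
  by rewrite -mulr_suml -rmorph_sum ler_piMl// -[1]/(1%:C) lecR.
have [S ST] := contraction_sqrt T_sa T_norm.
by exists S => u v; rewrite ST linearBl /= T_dot subrK.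
Qed.

Lemma clifford_dilation d (Y : 'I_d -> 'B(H)) (c : 'I_d -> R) m n
    (Z : 'M[R]_m) E w :
  (forall j, selfadj (Y j)) -> (forall j, `|Y j| <= (c j)%:C) ->
  \sum_j c j ^+ 2 <= 1 -> graded_clifford n Z E w -> (d < n)%N ->
  exists V : 'B(H, htens H m), (forall u v, '[V u, V v] = '[u, v]) /\
    forall (k : 'I_d) u v, '[ampl (E k) (V u), V v] = '[Y k u, v].
Proof.
move=> Y_sa Y_norm c1 C dn.
have [S SY] := row_contraction_defect Y_sa Y_norm c1.
(* [insub] fails exactly at the last index d, where the default value S is taken; the extra
   generator carries the defect. *)
pose Y' (i : 'I_d.+1) := oapp Y S (insub (i : nat)).
have Y'w k : Y' (widen_ord (leqnSn d) k) = Y k.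
  by rewrite /Y' /= valK.
have Y'm : Y' ord_max = S by rewrite /Y' insubF//= ltnn.
have Y'Y' u v : \sum_i '[Y' i u, Y' i v] = '[u, v].
  rewrite big_ord_recr /= Y'm -(SY u v) addrC; congr (_ + _).
  by apply: eq_bigr => k _; rewrite Y'w.
have [V [V_iso VE]] := clifford_compression C dn Y'Y'.
exists V; split=> // k u v.
have := VE (widen_ord (leqnSn d) k) u v; rewrite Y'w /= => ->.
by have /selfadjP<- := Y_sa k; field.
Qed.

(** For d >= 3 there are 2 (d - 1) > d generators and [clifford_dilation] applies directly; d = 2
    falls one short. *)
Lemma clifford_dilation_sharp d (Y : 'I_d -> 'B(H)) (c : 'I_d -> R) m
    (Z : 'M[R]_m) E w :
  (1 < d)%N -> (forall j, selfadj (Y j)) -> (forall j, `|Y j| <= (c j)%:C) ->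
  \sum_j c j ^+ 2 <= 1 -> graded_clifford (2 * d.-1) Z E w ->
  exists V : 'B(H, htens H m), (forall u v, '[V u, V v] = '[u, v]) /\
    forall (k : 'I_d) u v, '[ampl (E k) (V u), V v] = '[Y k u, v].
Proof.
move=> d1 Y_sa Y_norm c1 C.
have [d2|d2] := ltnP 2 d.
  have lt_pred k : (2 < k -> k < 2 * k.-1)%N.
    by case: k => [|[|[|k]]]// _; rewrite mul2n -addnn !addSn !addnS !ltnS leq_addl.
  exact: (clifford_dilation Y_sa Y_norm c1 C (lt_pred _ d2)).
have {d1 d2} dE : d = 2 by apply/eqP; rewrite eqn_leq d2 d1.
subst d.
(* Three generators on C^8: two for Y and one for the defect. *)
have [E' [w' C']] := graded_clifford_ex R (erefl (2 ^ 3)%N).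
have [V0 [V0_iso V0E]] := clifford_dilation Y_sa Y_norm c1 C' (ltnSn 2).
pose EB k : 'B(htens H (2 ^ 3)) := optens 1 (complexmx (E' k)).
have EB_sa k : (k < 3)%N -> selfadj (EB k).
  move=> k3; apply: optens_selfadj; last exact: (gc_tr C').
  exact/selfadjP.
have EBE k u : EB k u = ampl (E' k) u by exact: optens1E.
have EB_sqr k : (k < 3)%N -> EB k * EB k = 1.
  move=> k3; apply/bopP => u; rewrite -[LHS]/(EB k (EB k u)) !EBE ampl_mul (gc_sqr C')//.
  exact: ampl1.
have EB_anti : EB 0%N * EB 1%N = - (EB 1%N * EB 0%N).
  apply/bopP => u; rewrite -[LHS]/(EB 0%N (EB 1%N u)).
  rewrite -[RHS]/(- EB 1%N (EB 0%N u)) !EBE !ampl_mul.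
  by rewrite (gc_anti C' (i := 0%N) (j := 1%N))// amplN.
have [V [V_iso VE0 VE1]] := clifford2_compression (EB_sa 0%N isT) (EB_sa 1%N isT)
  (EB_sqr 0%N isT) (EB_sqr 1%N isT) EB_anti V0_iso C (ltnSn 1).
exists V; split=> // -[[|[|//]] k2] u v /=.
  by rewrite VE0 EBE; exact: (V0E (Ordinal k2)).
by rewrite VE1 EBE; exact: (V0E (Ordinal k2)).
Qed.

End contraction_tuples.

(** * The Clifford system graded by the tensor power of diag(1, -1) *)

Section grading.
Variable R : realType.

Lemma sigmaZ_map : sigmaZ R = map_mx (real_complex R) (pauliZ R).
Proof.
rewrite /pauliZ map_diag_mx /sigmaZ; congr diag_mx.
by apply/rowP => i; rewrite !mxE rmorph_sign.
Qed.

Lemma sigmaZ_ntens_map k :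
  sigmaZ R ^t k.+1 = map_mx (real_complex R) (pauliZ R ^t k.+1).
Proof.
elim: k => [|k IH]; first exact: sigmaZ_map.
rewrite ntensmxSS IH sigmaZ_map -[LHS](map_mxT (real_complex R)).
by [].
Qed.

Lemma sigmaZ_tens_clifford n : exists Z E w,
  graded_clifford (2 * n.+1) Z E w /\ sigmaZ_tens R n.+1 = complexmx Z.
Proof.
(* The predecessor puts the exponent in successor form; the cast is along the same equation as in
   [sigmaZ_tens]. *)
have [E [w C]] := graded_clifford_ex R (n := (2 * n.+1).-1) (expnM 2 2 n.+1).
eexists; exists E, w; split; first exact: C.
by rewrite /complexmx map_castmx -sigmaZ_ntens_map.
Qed.

End grading.

Theorem theorem4p13 (R : realType) (H : hilbertType R) (d : nat)
    (X : 'I_d -> 'B(H)) (a : 'I_d -> R) :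
  (0 < d)%N ->
  (forall j, selfadj (X j)) ->
  (forall j, `|X j| <= 1) ->
  (forall j, 0 < a j) ->
  \sum_(j < d) (a j) ^- 2 <= 1 ->
  exists A : 'I_d -> 'B(htens H (4 ^ d.-1)),
    (forall j, selfadj (A j)) /\ dilation X A /\
    [/\ forall j, `|A j| <= (a j)%:C,
        forall j k, j != k -> anticommute (A j) (A k),
        forall W, ACset X W ->
          forall j, anticommute (optens W (sigmaZ_tens R d.-1)) (A j)
      & forall j k l, real_cstar_gen X (blockentry (A j) k l)].
Proof.
move=> d0 X_sa X1 a0 a1.
case: d d0 X a X_sa X1 a0 a1 => [//|[|n]] _ X a X_sa X1 a0 a1.
  (* Case d = 1: the second factor is C^1 and [A j] is [X j] itself. *)
  exists (fun j => optens (X j) (complexmx 1%:M)); split; [|split; [|split]].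
  - by move=> j; apply: optens_selfadj; rewrite ?trmx1.
  - pose V : 'B(H, htens H 1) := Bop (@htens_inj_subproof R H 1 ord0).
    apply: (@dilation_compression _ _ _ _ _ _ V) => [u v|j u v].
      exact: htens_inj_dot.
    by rewrite [X in '[X, _]]optens_1inj; exact: htens_inj_dot.
  - move=> j; apply: le_trans (optens1_norm _ (X1 j)) _.
    (* The sum has a single term, so a_j^-2 <= 1 and therefore a_j >= 1. *)
    rewrite -[1]/(1%:C) lecR leNgt; apply/negP => aj1.
    move: a1; rewrite (bigD1 j)//= big1 ?addr0 => [|k]; last by rewrite !ord1 eqxx.
    rewrite leNgt => /negP; apply.
    by rewrite -exprVn exprn_egt1// invf_gt1.
  - by move=> j k; rewrite !ord1 eqxx.
  - move=> W [_ WX] j; rewrite /anticommute !optens_mul WX -optensNl.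
    by rewrite /complexmx map_mx1 mulmx1 mul1mx.
  - move=> j k l; rewrite blockentry_optens mxE.
    exact: real_cstar_gen_mem.
(* Here d = n + 2, and 2 (d - 1) = 2 (n + 1) generators are available. *)
have [Z [E [w [C ZE]]]] := sigmaZ_tens_clifford R n.
pose Y j : 'B(H) := (a j)^-1%:C *: X j.
have Y_sa j : selfadj (Y j).
  apply/selfadjP => u v; rewrite /= linearZl_LR linearZr_LR /= Num_conj_real.
  by have /selfadjP-> := X_sa j.
have Y_norm j : `|Y j| <= ((a j)^-1)%:C.
  have ai : 0 <= (a j)^-1%:C :> R[i] by rewrite ler0c invr_ge0 ltW.
  by rewrite normrZ (ger0_norm ai) ler_piMr.
have Y1 : \sum_j (a j)^-1 ^+ 2 <= 1.
  by apply: le_trans a1; rewrite le_eqVlt; apply/orP; left; apply/eqP;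
    apply: eq_bigr => j _; rewrite exprVn.
have [V [V_iso VE]] := clifford_dilation_sharp (d := n.+2) isT Y_sa Y_norm Y1 C.
have lt_n (j : 'I_n.+2) : (j < 2 * n.+1)%N.
  by apply: leq_trans (ltn_ord j) _; rewrite mulSn mul1n addSn ltnS leq_addl.
pose F (j : 'I_n.+2) := a j *: E j.
exists (fun j => optens 1 (complexmx (F j))); split; [|split; [|split]].
- move=> j; apply: optens_selfadj; first exact/selfadjP.
  by rewrite [LHS]linearZ /= (gc_tr C).
- apply: (@dilation_compression _ _ _ _ _ _ V) => // j u v.
  have -> : optens 1 (complexmx (F j)) (V u) = (a j)%:C *: ampl (E j) (V u).
    rewrite optens1E; apply/ffunP => k; rewrite !ffunE scaler_sumr.
    by apply: eq_bigr => l _; rewrite mxE scalerA rmorphM.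
  rewrite linearZl_LR /= VE /= linearZl_LR /= mulrA -rmorphM divff ?mul1r//.
  by rewrite gt_eqF.
- move=> j; apply: optens_clifford_norm; first exact: ltW.
  rewrite /F [(_ *: _)^T]linearZ /= -scalemxAl -scalemxAr scalerA (gc_tr C)//.
  by rewrite (gc_sqr C)// scalemx1 expr2.
- move=> j k jk; rewrite /anticommute !optens_mul -optensNr /complexmx.
  rewrite -!map_mxM -map_mxN; congr (optens _ (map_mx _ _)).
  rewrite /F -!scalemxAl -!scalemxAr !scalerA (gc_anti C)// scalerN.
  by rewrite mulrC.
(* W commutes with the factor 1 of [A j]; the sign comes from [E j] being odd for the grading. *)
- move=> W _ j; rewrite /anticommute /= ZE !optens_mul mulr1 mul1r -optensNr.
  rewrite /complexmx -!map_mxM -map_mxN; congr (optens _ (map_mx _ _)).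
  by rewrite /F -scalemxAl -scalemxAr (gc_odd C)// scalerN.
- move=> j k l; rewrite blockentry_optens mxE.
  exact: real_cstar_gen_scalar.
Qed.
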